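(* Let $X=\{X_u:u\in\mathbb Z^d\}$ and $Y=\{Y_u:u\in\mathbb Z^d\}$ be stationary random fields, independent of each other, with values in $A$ and $\hat A$ respectively. Assume that $\rho$ is bounded and that, for $\mathbb P$-almost every realization $x_{[0,\infty)}$ of $X_{[0,\infty)}$, conditional on $X_{[0,\infty)}=x_{[0,\infty)}$, the random variables $\{\rho_n(x_{C(n)},Y_{C(n)})\}$ satisfy a large deviations principle with some deterministic (not depending on $x_{[0,\infty)}$), convex rate-function. Then for all $D\in(D_{\rm min},D_{\rm av})$, except possibly at $D=D_{\rm min}^{(\infty)}$, $$\lim_{n\to\infty}-\frac1{n^d}\log Q_n(B(X_{C(n)},D))=R(\mathbb P,\mathbb Q,D)\quad\text{with probability one,}$$ where $$R(\mathbb P,\mathbb Q,D)=\lim_{n\to\infty}R_n(P_n,Q_n,D),\qquad R_n(P_n,Q_n,D)=\inf_{V_n}\frac1{n^d}H(V_n\|P_n\times Q_n),$$ the infimum being over all joint probability distributions $V_n$ on $A^{n^d}\times\hat A^{n^d}$ such that the $A^{n^d}$-marginal of $V_n$ is $P_n$ and $E_{V_n}[\rho_n(X_{C(n)},Y_{C(n)})]\le D$ (in particular the limit defining $R(\mathbb P,\mathbb Q,D)$ exists for such $D$), and $$D_{\rm min}^{(\infty)}=\inf\Big\{D\ge0:\sup_{n\ge1}R_n(P_n,Q_n,D)<\infty\Big\}.$$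
   Context: $d\ge2$. $A,\hat A$ are complete separable metric spaces with their Borel $\sigma$-fields. $\mathbb P,\mathbb Q$ are the laws of $X,Y$; stationary means invariant under all translations of $\mathbb Z^d$. $C(n)=\{u\in\mathbb Z^d:1\le u_j\le n\text{ for all }j\}$, $[0,\infty)=\{u\in\mathbb Z^d:u_j\ge0\text{ for all }j\}$, $X_U=\{X_u:u\in U\}$. $P_n,Q_n$ are the distributions of $X_{C(n)},Y_{C(n)}$. $\rho:A\times\hat A\to[0,\infty)$ is measurable, $\rho_n(x_{C(n)},y_{C(n)})=\frac1{n^d}\sum_{u\in C(n)}\rho(x_u,y_u)$, $B(x_{C(n)},D)=\{y_{C(n)}\in\hat A^{n^d}:\rho_n(x_{C(n)},y_{C(n)})\le D\}$. $D_{\rm av}=E_{P_1\times Q_1}[\rho(X,Y)]$; $D_{\rm min}^{(n)}=E_{P_n}[\operatorname{ess\,inf}_{Y_{C(n)}\sim Q_n}\rho_n(X_{C(n)},Y_{C(n)})]$; $D_{\rm min}=\sup_{n\ge1}D_{\rm min}^{(n)}=\lim_{n\to\infty}D_{\rm min}^{(n)}$. It is assumed that $D_{\rm min}<D_{\rm av}$. $\log$ is natural, with $-\log0=+\infty$; limits may equal $+\infty$. $H(W\|V)=E_W[\log\frac{dW}{dV}]$ if the density exists, $\infty$ otherwise. Large deviations principle: real random variables $Z_n$ satisfy the LDP (here with speed $n^d$) with rate-function $I:\mathbb R\to[0,\infty]$, $I$ lower semicontinuous, if for every Borel $\Gamma\subset\mathbb R$, $-\inf_{\Gamma^\circ}I\le\liminf_nn^{-d}\log\Pr\{Z_n\in\Gamma\}\le\limsup_nn^{-d}\log\Pr\{Z_n\in\Gamma\}\le-\inf_{\overline\Gamma}I$.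 *)

(* Defs.v *)
From HB Require Import structures.
From mathcomp Require Import all_boot all_order all_algebra.
From mathcomp Require Import all_classical all_reals all_analysis ess_sup_inf.
Import Order.TTheory GRing.Theory Num.Theory.
Import numFieldNormedType.Exports.

Set Implicit Arguments.
Unset Strict Implicit.
Unset Printing Implicit Defensive.

Local Open Scope classical_set_scope.
Local Open Scope ring_scope.

(* The class also carries a base point, which is needed for a measurable
   structure and only excludes the empty space. *)
#[short(type="completeMetricType")]
HB.structure Definition CompleteMetric (R : numDomainType) :=
  {T of CompletePseudoMetric R T & Metric R T}.

Definition separable_space (T : topologicalType) : Prop :=
  exists2 S : set T, countable S & dense S.

Definition borel (T : ptopologicalType) := g_sigma_algebraType (@open T).
HB.instance Definition _ (T : ptopologicalType) := Measurable.on (borel T).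

Section product_sigma_field.
Context {d : measure_display} (I : Type) (A : measurableType d).

Definition cylinders : set (set (I -> A)) :=
  \bigcup_(i : I) preimage_set_system setT (fun x : I -> A => x i) measurable.

(* [A^I] with the product sigma-field. *)
Definition conf := g_sigma_algebraType cylinders.
HB.instance Definition _ := Measurable.on conf.

End product_sigma_field.

Section relabeling.
Context {d : measure_display} {A : measurableType d} {I J : Type}.

Definition relabel (g : I -> J) (x : conf J A) : conf I A := fun i => x (g i).

Lemma measurable_relabel (g : I -> J) : measurable_fun setT (relabel g).
Proof.
apply: (@measurability _ _ _ (conf I A) _ _ (@cylinders _ I A)) => //.
move=> _ [_ [i _ [B mB <-]] <-].
rewrite !setTI; apply: sub_sigma_algebra; exists (g i) => //.
by exists B => //; rewrite setTI.
Qed.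

HB.instance Definition _ (g : I -> J) :=
  isMeasurableFun.Build _ _ _ _ (relabel g) (measurable_relabel g).

End relabeling.

Definition restr {d : measure_display} {A : measurableType d} {S : Type}
    (U : set S) : {mfun conf S A >-> conf U A} :=
  relabel (fun u : U => val u).

Definition marginal {d : measure_display} {A : measurableType d} {S : Type}
    {R : realType} (P : probability (conf S A) R) (U : set S) :
    probability (conf U A) R :=
  distribution P (restr U).

Section lattice.
Variable d : nat.

Local Notation Zd := 'rV[int]_d.

Definition cube (n : nat) : set Zd :=
  [set u | forall j, 1 <= u 0 j <= n%:Z].

Definition orthant : set Zd := [set u | forall j, 0 <= u 0 j].

Lemma cube_orthant (n : nat) : cube n `<=` orthant.
Proof. by move=> u un j; have /andP[/(le_trans ler01)] := un j. Qed.

Definition stationary {dA : measure_display} {A : measurableType dA}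
    {R : realType} (P : probability (conf Zd A) R) : Prop :=
  forall (v : Zd) (E : set (conf Zd A)), measurable E ->
    P (relabel (fun u => u + v) @^-1` E) = P E.

End lattice.

Arguments cube : clear implicits.
Arguments orthant : clear implicits.
Arguments cube_orthant {d} n.

Definition independent_rv {d d1 d2 : measure_display} {T : measurableType d}
    {T1 : measurableType d1} {T2 : measurableType d2} {R : realType}
    (Pr : probability T R) (X : {mfun T >-> T1}) (Y : {mfun T >-> T2}) : Prop :=
  forall (E : set T1) (F : set T2), measurable E -> measurable F ->
    Pr (X @^-1` E `&` Y @^-1` F) = (Pr (X @^-1` E) * Pr (Y @^-1` F))%E.

Section large_deviations.
Context {d : measure_display} {T : measurableType d} {R : realType}.
Local Open Scope ereal_scope.

(* At the endpoints t = 0, 1 the convention 0 * +oo = 0 is used. *)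
Definition convex_ereal (I : R -> \bar R) : Prop :=
  forall (x y t : R), (0 <= t <= 1)%R ->
    I (t * x + (1 - t) * y)%R <= t%:E * I x + (1 - t)%:E * I y.

Definition rate_function (I : R -> \bar R) : Prop :=
  (forall x, 0 <= I x) /\ lower_semicontinuous I.

(* [lne 0 = -oo], and the infimum over the empty set is [+oo]. *)
Definition LDP (Pr : probability T R) (Z : nat -> T -> R) (speed : nat -> R)
    (I : R -> \bar R) : Prop :=
  rate_function I /\
  forall G : set R, measurable G ->
    let a n := (speed n)^-1%:E * lne (Pr (Z n @^-1` G)) in
    - ereal_inf (I @` interior G) <= limn_einf a /\
    limn_esup a <= - ereal_inf (I @` closure G).

End large_deviations.

(* [W `<< V] is the existence of a density, by the Radon-Nikodym theorem. *)
Definition relative_entropy {d : measure_display} {T : measurableType d}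
    {R : realType} (W V : probability T R) : \bar R :=
  if `[< W `<< V >]
  then (\int[W]_z lne (Radon_Nikodym (charge_of_finite_measure W) V z))%E
  else +oo%E.

Section distortion.
Context {R : realType} {dA dB : measure_display}.
Context {A : measurableType dA} {B : measurableType dB}.
Variables (d : nat) (rho : A * B -> R).
Local Notation Zd := 'rV[int]_d.

Definition rho_n (n : nat) (x : conf (cube d n) A) (y : conf (cube d n) B) : R :=
  (n ^ d)%:R^-1 * \sum_(u \in [set: cube d n]) rho (x u, y u).

Definition distortion_ball (n : nat) (x : conf (cube d n) A) (D : R) :
    set (conf (cube d n) B) :=
  [set y | rho_n x y <= D].

Local Open Scope ereal_scope.

Definition admissible (n : nat) (Pn : probability (conf (cube d n) A) R) (D : R)
    (V : probability (conf (cube d n) A * conf (cube d n) B)%type R) : Prop :=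
  (forall E, measurable E -> V (fst @^-1` E) = Pn E) /\
  \int[V]_z (rho_n z.1 z.2)%:E <= D%:E.

Definition R_n (n : nat) (Pn : probability (conf (cube d n) A) R)
    (Qn : probability (conf (cube d n) B) R) (D : R) : \bar R :=
  ereal_inf [set (n ^ d)%:R^-1%:E * relative_entropy V (Pn \x Qn)
            | V in admissible Pn D].

Variables (P : probability (conf Zd A) R) (Q : probability (conf Zd B) R).

Local Notation P_ n := (marginal P (cube d n)).
Local Notation Q_ n := (marginal Q (cube d n)).

Definition R_seq (D : R) (n : nat) : \bar R := R_n (P_ n) (Q_ n) D.

Definition R_lim (D : R) : \bar R := limn (R_seq D).

(* [cube d 1] is the single site (1, ..., 1), so that [P_ 1] and [Q_ 1] are the
   one-site marginals. *)
Definition D_av : \bar R := \int[P_ 1 \x Q_ 1]_z (rho_n z.1 z.2)%:E.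

Definition D_min_n (n : nat) : \bar R :=
  \int[P_ n]_x ess_inf (Q_ n) (fun y => (rho_n x y)%:E).

Definition D_min : \bar R := ereal_sup [set D_min_n n | n in [set n | (1 <= n)%N]].

Definition D_min_infty : \bar R :=
  ereal_inf [set D%:E | D in [set D : R | (0 <= D)%R /\
    ereal_sup [set R_seq D n | n in [set n | (1 <= n)%N]] < +oo]].

End distortion.

(* Main.v *)
Require Import Defs.
From HB Require Import structures.
From mathcomp Require Import all_boot all_order all_algebra.
From mathcomp Require Import all_classical all_reals all_analysis.
From mathcomp Require Import measurable_realfun ess_sup_inf lra ring.
Import Order.TTheory GRing.Theory Num.Theory.
Import numFieldNormedType.Exports.

Set Implicit Arguments.
Unset Strict Implicit.
Unset Printing Implicit Defensive.

Local Open Scope classical_set_scope.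
Local Open Scope ring_scope.

(** Write [N = n ^ d], [q n x t] for the [Q_n]-probability of the distortion
ball of radius [t] around the [n]-block of [x], and [J t] for the infimum of
the rate function [I] over [z <= t].

For a fixed radius [D], the large deviations principle squeezes
[- N^-1 * log (q n x D)] between [J D] and the infimum of [I] over [z < D].
By convexity these two agree as soon as [I] is finite somewhere to the left of
[D] ([convex_inf_half_line]), and both are infinite when [I] is infinite to
the left of [D]. So the ball probabilities decay at the rate [J D]
([ball_prob_cvg]), and what has to be shown is that [R_n] has the same limit.

- [R_n] is asymptotically at most [J D]. Couple the source block [x] with a
  reproduction block drawn from [Q_n] conditioned on the ball of radius
  [D' < D] around [x]. The density of this coupling is at most [1 / q n x D'],
  so its relative entropy is at most [N * b] if all these probabilities are at
  least [exp (- N * b)]. The few blocks [x] for which they are smaller are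
  coupled with an independent [Q_n]-block instead: since the distortion is
  bounded, a set of blocks of vanishing probability changes the expected
  distortion by a vanishing amount, which the gap [D - D'] absorbs
  ([tilting_bounded], [R_seq_le_eventually]).

- [R_n] is asymptotically at least [J D]. If an affine function
  [z |-> j + l * (z - D)] of slope [l <= 0] lies below [I], the upper bound of
  the large deviations principle on half-lines bounds the Laplace transform
  [E exp (N * l * rho_n x Y)] by about [exp (N * (l * D - j))]
  ([laplace_le_grid]). The variational inequality for relative entropy
  ([relative_entropy_ge]) then gives [R_n >= j - o(1)] at [D]
  ([R_seq_ge_eventually]). A subgradient of [I] provides such an affine
  function with [j = J D] when [I] is finite somewhere to the left of [D]
  ([convex_subgradient]). When [I] is infinite up to some [D' > D], steep
  affine functions vanishing at [D'] provide it with [j] arbitrarily large.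

The only remaining case is that [D] is the left end of the domain of [I].
There [R_n] tends to infinity at every level below [D] and is bounded at every
level above [D]: its limsup is finite, and each single term is finite because
the level exceeds [D_min] ([finite_entropy_above_ess_inf]). Hence
[D = D_min_infty] ([D_min_infty_boundary]), which is the excluded value. *)

(** * Limits of extended real sequences *)

Section extended_sequences.
Context {R : realType}.
Implicit Types (u : (\bar R)^nat) (l x : \bar R).
Local Open Scope ereal_scope.

Lemma cvge_near_lt u l x :
  u @ \oo --> l -> l < x -> \forall n \near \oo, u n < x.
Proof.
move=> ul lx; suff /ul : nbhs l [set y | y < x] by [].
by apply: open_nbhs_nbhs; split => //;
  exact: open_ereal_lt_ereal.
Qed.

Lemma limn_esup_near_lt u x : limn_esup u < x -> \forall n \near \oo, u n < x.
Proof.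
rewrite /limn_esup limf_esupE => /ereal_inf_lt[_ [V V_oo <-]] Vx.
apply: filterS V_oo => n Vn; apply: le_lt_trans Vx.
by apply: ereal_sup_ubound; exists n.
Qed.

Lemma limn_einf_near_gt u x : x < limn_einf u -> \forall n \near \oo, x < u n.
Proof.
rewrite /limn_einf lteNr => /limn_esup_near_lt.
by apply: filterS => n; rewrite lteN2.
Qed.

Lemma limn_esup_le_near u x : (\forall n \near \oo, u n <= x) -> limn_esup u <= x.
Proof.
move=> ux; rewrite /limn_esup limf_esupE.
apply: (@le_trans _ _ (ereal_sup [set u n | n in [set n | u n <= x]])).
  by apply: ereal_inf_lbound; exists [set n | u n <= x].
by apply: ge_ereal_sup => _ [n /= ? <-].
Qed.

Lemma le_limn_einf_near u x : (\forall n \near \oo, x <= u n) -> x <= limn_einf u.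
Proof.
move=> xu; rewrite /limn_einf leeNr; apply: limn_esup_le_near.
by apply: filterS xu => n; rewrite leeN2.
Qed.

Lemma cvg_limn_esup_einf u l : limn_esup u <= l -> l <= limn_einf u -> u @ \oo --> l.
Proof.
move=> sl li.
have sE : limn_esup u = l.
  by apply/eqP; rewrite eq_le sl (le_trans li)// limn_einf_sup.
have iE : limn_einf u = l.
  by apply/eqP; rewrite eq_le li andbT (le_trans (limn_einf_sup u)).
apply: (@squeeze_cvge _ _ _ _ (einfs u) u (esups u)).
- apply: nearW => n; apply/andP; split.
  + by apply: ereal_inf_lbound; exists n => /=.
  + by apply: ereal_sup_ubound; exists n => /=.
- by rewrite -iE limn_einf_lim; exact: is_cvg_einfs.
- by rewrite -sE limn_esup_lim; exact: is_cvg_esups.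
Qed.

End extended_sequences.

(** * Bounds on the relative entropy *)

Section entropy_bounds.
Context {d : measure_display} {T : measurableType d} {R : realType}.
Local Open Scope ereal_scope.

Lemma measurable_lne_EFin (f : T -> R) :
  measurable_fun setT f -> measurable_fun setT (fun x => lne (f x)%:E).
Proof.
move=> mf.
rewrite (_ : (fun _ => _) = fun x => if (0 < f x)%R then (ln (f x))%:E else -oo).
  apply: measurable_fun_ifT => //; first exact: measurable_fun_ltr.
  exact/measurable_EFinP/(measurableT_comp (@measurable_ln R)).
apply/funext => x; case: ltP => [/lne_EFin//|fx0].
by rewrite le0_lneNy// lee_fin.
Qed.

(** Comparison of integrals of functions that may fail to be integrable: an
integrable minorant controls the negative part, and the positive part may have
an infinite integral. *)
Lemma ae_le_integral_minorant (m : {measure set T -> \bar R}) (h k : T -> \bar R) :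
  m.-integrable setT h -> measurable_fun setT k -> {ae m, forall x, h x <= k x} ->
  \int[m]_x h x <= \int[m]_x k x.
Proof.
move=> ih mk hk; have mh := measurable_int _ ih.
rewrite integralE [leRHS]integralE; apply: leeB.
  apply: ae_ge0_le_integral => //; try exact: measurable_funepos.
  by apply: filterS hk => x hkx _; rewrite !funeposE ge_max !le_max hkx lexx orbT.
apply: ae_ge0_le_integral => //; try exact: measurable_funeneg.
apply: filterS hk => x hkx _.
by rewrite !funenegE ge_max !le_max leeN2 hkx lexx orbT.
Qed.

Lemma integral_probability_cst (P : probability T R) (r : R) :
  \int[P]_x r%:E = r%:E.
Proof.
rewrite (integral_cst P measurableT).
by rewrite [X in _ * X](_ : _ = 1) ?mule1//; exact: probability_setT.
Qed.

Variables V mu : probability T R.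

(** The density in the definition of the relative entropy comes from the
signed-measure version of the Radon-Nikodym theorem, so it is nonnegative only
almost everywhere. It is replaced here by an everywhere nonnegative real one. *)
Lemma relative_entropy_density : V `<< mu ->
  exists f : T -> R, [/\ measurable_fun setT f, forall x, (0 <= f x)%R,
    forall E, measurable E -> V E = \int[mu]_(x in E) (f x)%:E,
    forall h : T -> R, measurable_fun setT h -> (forall x, 0 <= h x)%R ->
      \int[V]_x (h x)%:E = \int[mu]_x (h x * f x)%:E &
    relative_entropy V mu = \int[V]_x lne (f x)%:E].
Proof.
move=> Vmu; pose g := Radon_Nikodym_SigmaFinite.f V mu.
have gfin x : g x \is a fin_num by exact: Radon_Nikodym_SigmaFinite.f_fin_num.
have mg : measurable_fun setT g.
  exact: measurable_int (Radon_Nikodym_SigmaFinite.f_integrable Vmu).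
have mfg : measurable_fun setT (fine \o g) by exact: measurableT_comp.
have fgE x : (fine (g x))%:E = g x by rewrite fineK.
exists (fun x => fine (g x)); split => //.
- by move=> x; rewrite -lee_fin fgE; exact: Radon_Nikodym_SigmaFinite.f_ge0.
- move=> E mE; rewrite (Radon_Nikodym_SigmaFinite.f_integral Vmu)//.
  by apply: eq_integral => x _; rewrite fgE.
- move=> h mh h0.
  rewrite -(Radon_Nikodym_SigmaFinite.change_of_variables Vmu)//; last first.
    exact/measurable_EFinP.
  by apply: eq_integral => x _; rewrite EFinM fgE.
rewrite /relative_entropy asboolT//.
pose g' := Radon_Nikodym (charge_of_finite_measure V) mu.
have g'fin x : g' x \is a fin_num by exact: Radon_Nikodym_fin_num.
have mg' : measurable_fun setT (fine \o g').
  apply: measurableT_comp => //.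
  exact: measurable_int (Radon_Nikodym_integrable _).
apply: ae_eq_integral => //.
- under eq_fun do rewrite -[Radon_Nikodym _ _ _]fineK//.
  exact: measurable_lne_EFin.
- exact: measurable_lne_EFin.
- apply: (null_dominates_ae_eq _ Vmu) => //.
  have := ae_eq_Radon_Nikodym_SigmaFinite Vmu measurableT.
  by apply: filterS => x H _; rewrite fgE -H.
Qed.

(** A domination [V <= expR K * mu] forces the density to be at most [expR K]
outside a [V]-null set. *)
Lemma relative_entropy_le (K : R) :
  (forall E, measurable E -> V E <= (expR K)%:E * mu E) ->
  relative_entropy V mu <= K%:E.
Proof.
move=> VK.
have K0 : (0 <= K)%R.
  have := VK _ measurableT; rewrite !probability_setT mule1 lee_fin.
  by rewrite -expR0 ler_expR.
have Vmu : V `<< mu.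
  apply/null_content_dominatesP => E mE E0; apply/eqP; rewrite eq_le measure_ge0.
  by rewrite andbT; have := VK _ mE; rewrite E0 mule0.
have [f [mf f0 Vf _ ->]] := relative_entropy_density Vmu.
pose N := [set x | (expR K < f x)%R].
have mN : measurable N.
  rewrite /N -[X in measurable X]setTI.
  exact: (measurable_fun_ltr (measurable_cst _) mf measurableT (Y := [set true])).
have mfN : measurable_fun N f by exact: measurable_funTS.
have VN0 : V N = 0.
  suff muN0 : mu N = 0 by have /null_content_dominatesP := Vmu; apply.
  have iN : \int[mu]_(x in N) `|(f x - expR K)%:E| = 0.
    apply/eqP; rewrite eq_le integral_ge0 ?andbT//.
    have -> : \int[mu]_(x in N) `|(f x - expR K)%:E| =
              \int[mu]_(x in N) ((f x)%:E - (expR K)%:E).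
      by apply: eq_integral => x; rewrite inE => /= Nx; rewrite gtr0_norm ?subr_gt0.
    rewrite integralB_EFin//; last 2 first.
    - apply/integrableP; split; first exact/measurable_EFinP.
      under eq_integral do rewrite /= ger0_norm//.
      by rewrite -Vf// (le_lt_trans (probability_le1 _ _))// ltry.
    - apply: measurable_bounded_integrable => //.
      + by rewrite (le_lt_trans (probability_le1 _ _))// ltry.
      + by exists (expR K); split => // y Ky x _; rewrite ger0_norm ?expR_ge0// ltW.
    rewrite -Vf// [X in _ - X]integral_cst//.
    rewrite -[leRHS](subee (x := (expR K)%:E * mu N)); last first.
      by rewrite fin_numM// fin_num_measure.
    by apply: leeB => //; exact: VK.
  have /ae_eq_integral_abs := iN; move/(_ mN) => H.
  have {}H : ae_eq mu N (fun x => (f x - expR K)%:E) (cst 0).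
    by apply: H; apply/measurable_EFinP; exact: measurable_funB.
  have [A [mA muA0 NA]] := H.
  apply/eqP; rewrite eq_le measure_ge0 andbT -muA0; apply: le_measure; rewrite ?inE//.
  move=> x Nx; apply: NA => /= /(_ Nx) [] /eqP; rewrite subr_eq0 => /eqP fxK.
  by move: Nx; rewrite /N /= fxK ltxx.
rewrite integralE; apply: (@le_trans _ _ (\int[V]_x (fun x => lne (f x)%:E) ^\+ x)).
  by rewrite -[leRHS]sube0; apply: leeB => //; exact: integral_ge0.
rewrite -(integral_probability_cst V K).
apply: ae_ge0_le_integral => //.
- by apply: measurable_funepos; exact: measurable_lne_EFin.
exists N; split => // x /=; apply: contra_notP => /negP; rewrite -leNgt => fK _.
rewrite !funeposE ge_max lee_fin K0 andbT.
case: (leP (f x) 0%R) => [_|fx]; first by rewrite leNye.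
by rewrite lee_fin -[K]expRK ler_ln// posrE ?expR_gt0.
Qed.

(** The Donsker-Varadhan inequality. With [f] the density, [1 + u <= expR u]
at [u = phi - ln f] gives [phi + 1 - expR phi / f <= ln f] wherever [f] is
positive, that is [V]-almost everywhere, and the [V]-integral of
[expR phi / f] is at most the [mu]-integral of [expR phi]. *)
Lemma relative_entropy_ge (phi : T -> R) (b : R) :
  measurable_fun setT phi -> (forall x, `|phi x| <= b)%R ->
  \int[mu]_x (expR (phi x))%:E <= 1 ->
  \int[V]_x (phi x)%:E <= relative_entropy V mu.
Proof.
move=> mphi phib ephi.
case: (pselect (V `<< mu)) => Vmu; last by rewrite /relative_entropy asboolF// leey.
have [f [mf f0 Vf cov ->]] := relative_entropy_density Vmu.
(* This is [expR phi / f], written so that its measurability is immediate. *)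
pose w x := (if (0 < f x) then expR (phi x - ln (f x)) else 0)%R.
have mpos : measurable_fun setT (fun x => (0 < f x)%R) by exact: measurable_fun_ltr.
have me : measurable_fun setT (fun x => expR (phi x)).
  exact: (measurableT_comp (@measurable_expR R)).
have w0 x : (0 <= w x)%R.
  by rewrite /w; case: ifPn => // _; exact: expR_ge0.
have mw : measurable_fun setT w.
  apply: measurable_fun_ifT => //.
  apply: (measurableT_comp (@measurable_expR R)); apply: measurable_funB => //.
  exact: (measurableT_comp (@measurable_ln R)).
have iw1 : \int[V]_x (w x)%:E <= 1.
  rewrite cov//; apply: le_trans ephi; apply: ge0_le_integral => //.
  - by move=> x _; rewrite lee_fin mulr_ge0.
  - by apply/measurable_EFinP; exact: measurable_funM.
  - exact/measurable_EFinP.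
  - move=> x _; rewrite lee_fin /w; case: ifPn => [fx|_]; last by rewrite mul0r expR_ge0.
    by rewrite expRD expRN lnK ?posrE// divfK// gt_eqF.
have iw : V.-integrable setT (EFin \o w).
  apply/integrableP; split; first exact/measurable_EFinP.
  under eq_integral do rewrite /= ger0_norm//.
  by rewrite (le_lt_trans iw1)// ltry.
have iphi : V.-integrable setT (EFin \o phi).
  apply: measurable_bounded_integrable => //.
    by rewrite -ge0_fin_numE// fin_num_measure.
  exists b; split; first exact: num_real.
  by move=> y by_ x _; exact: le_trans (phib x) (ltW by_).
have i1 : V.-integrable setT (EFin \o cst (1%R:R)).
  exact: finite_measure_integrable_cst.
have iphi1 : V.-integrable setT (EFin \o (phi \+ cst 1%R)%R).
  by rewrite (_ : _ \o _ = (EFin \o phi) \+ (EFin \o cst (1%R:R)))//; exact: integrableD.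
have : \int[V]_x ((phi x + 1)%:E - (w x)%:E) <= \int[V]_x lne (f x)%:E.
  apply: ae_le_integral_minorant.
  - exact: (integrableB measurableT iphi1 iw).
  - exact: measurable_lne_EFin.
  pose N := (fun x => 0 < f x)%R @^-1` [set false].
  have mN : measurable N by rewrite -[N]setTI; exact: mpos.
  exists N; split => //.
    transitivity (\int[mu]_(x in N) (f x)%:E); first exact: Vf.
    rewrite (eq_integral (cst 0)) ?integral0//= => x.
    rewrite inE /N /= ltNge => /negbFE fx.
    by congr EFin; apply/eqP; rewrite eq_le fx f0.
  move=> x /=; apply: contra_notP => /eqP; rewrite eqbF_neg negbK => fx.
  rewrite /w fx (leNgt (f x)) fx /= -EFinB lee_fin.
  by have := expR_ge1Dx (phi x - ln (f x)); lra.
rewrite integralB_EFin//; apply: le_trans.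
rewrite (_ : \int[V]_x (phi x + 1)%:E = \int[V]_x (phi x)%:E + 1); last first.
  under eq_integral do rewrite EFinD.
  by rewrite integralD_EFin// integral_probability_cst.
rewrite leeBrDr//; last first.
  by apply: integrable_fin_num.
by rewrite leeD2l.
Qed.

End entropy_bounds.

(** * Conditioning the second coordinate on sublevel sets *)

Section density.
Context {d : measure_display} {T : measurableType d} {R : realType}.
Local Open Scope ereal_scope.

Lemma probability_of_density (mu : {measure set T -> \bar R}) (f : T -> R) :
  measurable_fun setT f -> (forall x, 0 <= f x)%R -> \int[mu]_x (f x)%:E = 1 ->
  exists V : probability T R,
    forall E, measurable E -> V E = \int[mu]_(x in E) (f x)%:E.
Proof.
move=> mf f0 f1; pose nu E := \int[mu]_(x in E) (f x)%:E.
have nu0 : nu set0 = 0 by rewrite /nu integral_set0.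
have nu_ge0 E : 0 <= nu E by apply: integral_ge0 => x _; rewrite lee_fin.
have nu_sigma : semi_sigma_additive nu.
  move=> /= F mF tF mUF; rewrite /nu; apply: cvg_toP.
    apply: ereal_nondecreasing_is_cvgn => m n mn.
    by apply: lee_sum_nneg_natr => // k _ _; exact: nu_ge0.
  rewrite ge0_integral_bigcup//=.
  - by apply: measurable_funTS; exact/measurable_EFinP.
  - by move=> x _; rewrite lee_fin.
pose m : measure T R := HB.pack nu (isMeasure.Build d T R nu nu0 nu_ge0 nu_sigma).
pose V : probability T R := HB.pack (m : set T -> \bar R) m
  (Measure_isProbability.Build d T R m f1).
by exists V.
Qed.

End density.

Section tilting.
Context {d1 d2 : measure_display} {T1 : measurableType d1} {T2 : measurableType d2}.
Context {R : realType} (P : probability T1 R) (Q : probability T2 R).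
Variables (r : T1 * T2 -> R) (mr : measurable_fun setT r).
Local Open Scope ereal_scope.

Lemma measurable_sublevel (t : T1 -> R) (x : T1) :
  measurable [set y | (r (x, y) <= t x)%R].
Proof.
rewrite -[X in measurable X]setTI.
have mrx : measurable_fun setT (fun y => r (x, y)).
  exact: (measurableT_comp mr (pair1_measurable x)).
exact: (measurable_fun_ler mrx (measurable_cst _) measurableT (Y := [set true])).
Qed.

Lemma measurable_sublevelT (t : T1 -> R) : measurable_fun setT t ->
  measurable [set z | (r z <= t z.1)%R].
Proof.
move=> mt; rewrite -[X in measurable X]setTI.
exact: (measurable_fun_ler mr (measurableT_comp mt measurable_fst) measurableT
  (Y := [set true])).
Qed.

Lemma measurable_prob_sublevel (t : T1 -> R) : measurable_fun setT t ->
  measurable_fun setT (fun x => fine (Q [set y | (r (x, y) <= t x)%R])).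
Proof.
move=> mt; apply: measurableT_comp => //.
have := measurable_fun_xsection Q (measurable_sublevelT mt).
apply: eq_measurable_fun => x _ /=; congr (Q _).
by apply/seteqP; split => y; rewrite /xsection/= inE.
Qed.

(** Draw [x] from [P], then [y] from [Q] conditioned on [r (x, y) <= t x]. The
density with respect to [P \x Q] is the indicator of the sublevel set divided
by its conditional probability [q x], hence at most [expR K]. Its [y]-integral
is 1 for every [x], so the first marginal is still [P]. *)
Lemma tilting (t : T1 -> R) (K D : R) :
  measurable_fun setT t -> (forall z, 0 <= r z)%R -> (forall x, 0 <= t x)%R ->
  (forall x, (expR (- K))%:E <= Q [set y | r (x, y) <= t x]%R) ->
  \int[P]_x (t x)%:E <= D%:E ->
  exists V : probability (T1 * T2)%type R,
    [/\ forall E, measurable E -> V (fst @^-1` E) = P E,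
        \int[V]_z (r z)%:E <= D%:E &
        relative_entropy V (P \x Q) <= K%:E].
Proof.
move=> mt r0 t0 tK tD.
pose q x := fine (Q [set y | (r (x, y) <= t x)%R]).
have qE x : (q x)%:E = Q [set y | (r (x, y) <= t x)%R].
  by rewrite fineK// fin_num_measure//; exact: measurable_sublevel.
have qK x : (expR (- K) <= q x)%R by rewrite -lee_fin qE.
have q0 x : (0 < q x)%R by exact: lt_le_trans (expR_gt0 _) (qK x).
have mq : measurable_fun setT q by exact: measurable_prob_sublevel.
pose W := [set z | (r z <= t z.1)%R].
have mW : measurable W by exact: measurable_sublevelT.
pose f z := (\1_W z * expR (- ln (q z.1)))%R.
have f0 z : (0 <= f z)%R by rewrite mulr_ge0// expR_ge0.
have mf : measurable_fun setT f.
  apply: measurable_funM; first exact: measurable_indic.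
  apply: (measurableT_comp (@measurable_expR R)).
  apply: measurableT_comp => //; apply: (measurableT_comp (@measurable_ln R)).
  exact: (measurableT_comp mq measurable_fst).
have mfE : measurable_fun setT (EFin \o f) by exact/measurable_EFinP.
have int_f E : measurable E ->
    \int[P \x Q]_(z in fst @^-1` E) (f z)%:E = P E.
  move=> mE; rewrite integral_mkcond fubini_tonelli1; last 2 first.
  - apply/(measurable_restrictT _ _).1 => //; last exact: measurable_funTS.
    by rewrite -[fst @^-1` E]setTI; exact: measurable_fst.
  - by move=> z; apply: erestrict_ge0 => ? _; rewrite lee_fin.
  rewrite (eq_integral (fun x => (\1_E x)%:E)).
    by rewrite integral_indic// setIT.
  move=> x _; rewrite /fubini_F.
  rewrite (eq_integral (fun y => ((\1_E x * expR (- ln (q x)))%:E *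
      (\1_[set y | (r (x, y) <= t x)%R] y)%:E))).
    rewrite ge0_integralZl//.
    - rewrite integral_indic//; last exact: measurable_sublevel.
      rewrite setIT [X in _ * X](_ : _ = (q x)%:E); last exact/esym/qE.
      rewrite -EFinM expRN lnK ?posrE//.
      by rewrite -mulrA mulVf ?mulr1// gt_eqF.
    - by apply/measurable_EFinP; apply: measurable_indic; exact: measurable_sublevel.
  move=> y _; rewrite -EFinM patchE /f !indicE.
  have -> : ((x, y) \in W) = (y \in [set y | (r (x, y) <= t x)%R]).
    by apply/idP/idP; rewrite !inE.
  have -> : ((x, y) \in fst @^-1` E) = (x \in E) by apply/idP/idP; rewrite !inE.
  case: (x \in E); last by rewrite !mul0r.
  by rewrite mul1r mulrC.
have [|V VE] := probability_of_density mf f0 (mu := (P \x Q)).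
  by rewrite -[setT](preimage_setT fst) int_f// probability_setT.
have VfE E : measurable E -> V (fst @^-1` E) = P E.
  move=> mE; rewrite VE ?int_f//.
  by rewrite -[fst @^-1` E]setTI; exact: measurable_fst.
exists V; split => //.
- apply: le_trans tD.
  have -> : \int[P]_x (t x)%:E = \int[V]_z (t z.1)%:E.
    transitivity (\int[pushforward V fst]_x (t x)%:E).
      by apply: eq_measure_integral => E mE _; exact/esym/VfE.
    rewrite ge0_integral_pushforward//.
    + exact/measurable_EFinP.
    + by move=> x _; rewrite lee_fin.
  apply: ae_ge0_le_integral => //.
  + by move=> z _; rewrite lee_fin.
  + exact/measurable_EFinP.
  + by move=> z _; rewrite lee_fin.
  + by apply/measurable_EFinP; exact: measurableT_comp.
  exists (~` W); split; first exact: measurableC.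
    transitivity (\int[P \x Q]_(z in ~` W) (f z)%:E).
      by apply: VE; exact: measurableC.
    rewrite (eq_integral (cst 0)) ?integral0// => z.
    by rewrite inE => nWz; rewrite /f indicE memNset// mul0r.
  by apply: subsetC => z; rewrite /W /= lee_fin.
- apply: relative_entropy_le => E mE; rewrite VE//.
  rewrite -integral_cst//; apply: ge0_le_integral => //.
  + by move=> z _; rewrite lee_fin.
  + exact: measurable_funTS.
  + move=> z _; rewrite lee_fin /f indicE.
    case: (z \in W); rewrite ?mul0r ?expR_ge0// mul1r ler_expR.
    by rewrite -[leRHS]opprK lerN2 -[(- K)%R]expRK ler_ln ?posrE ?expR_gt0.
Qed.

End tilting.

(** * Couplings for a bounded cost *)

Section tilting_bounded.
Context {d1 d2 : measure_display} {T1 : measurableType d1} {T2 : measurableType d2}.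
Context {R : realType} (P : probability T1 R) (Q : probability T2 R).
Variables (r : T1 * T2 -> R) (mr : measurable_fun setT r).
Hypothesis r0 : forall z, (0 <= r z)%R.
Variables (M : R) (rM : forall z, (r z <= M)%R).
Local Open Scope ereal_scope.

Lemma measurable_rare_sublevel (t : T1 -> R) (K : R) : measurable_fun setT t ->
  measurable [set x | Q [set y | (r (x, y) <= t x)%R] < (expR (- K))%:E].
Proof.
move=> mt; have mq := measurable_prob_sublevel Q mr mt.
have := measurable_fun_ltr mq (measurable_cst (expR (- K))) measurableT (Y := [set true]).
rewrite setTI => /(_ I); congr measurable; apply/seteqP; split => x /=;
  by rewrite -lte_fin fineK// fin_num_measure//; exact: measurable_sublevel.
Qed.

(** The levels [t x] are kept where conditioning is cheap. On the other points
[x] the level is raised to the uniform bound [M], which amounts to not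
conditioning at all and costs at most [M] times their probability. *)
Lemma tilting_bounded (t : T1 -> R) (K D : R) :
  measurable_fun setT t -> (forall x, 0 <= t x)%R -> (0 <= K)%R ->
  \int[P]_x (t x)%:E +
    M%:E * P [set x | Q [set y | (r (x, y) <= t x)%R] < (expR (- K))%:E] <= D%:E ->
  exists V : probability (T1 * T2)%type R,
    [/\ forall E, measurable E -> V (fst @^-1` E) = P E,
        \int[V]_z (r z)%:E <= D%:E &
        relative_entropy V (P \x Q) <= K%:E].
Proof.
move=> mt t0 K0 tD.
set bad := [set x | _] in tD.
have mbad : measurable bad by exact: measurable_rare_sublevel.
have M0 : (0 <= M)%R by have := r0 point; have := rM point; lra.
pose T x := if x \in bad then M else t x.
have mT : measurable_fun setT T.
  apply: measurable_fun_ifT => //.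
  rewrite (_ : (fun _ => _) = (fun x => (\1_bad x : R) == 1%R)); last first.
    by apply/funext => x; rewrite indicE; case: (x \in bad); rewrite ?eqxx// eq_sym oner_eq0.
  by apply: measurable_fun_eqr => //; exact: measurable_indic.
apply: (@tilting _ _ _ _ _ P Q r mr T) => //.
- by move=> x; rewrite /T; case: ifP.
- move=> x; rewrite /T; case: ifPn => [_|]; last first.
    by rewrite notin_setE /bad /= => /negP; rewrite -leNgt.
  (* Off the good points the level is [M] and the sublevel set is everything. *)
  rewrite [X in Q X](_ : _ = setT); last by apply/seteqP; split => // y _; exact: rM.
  rewrite [leRHS](_ : _ = 1); last exact: probability_setT.
  by rewrite lee_fin -expR0 ler_expR; lra.
- apply: le_trans tD.
  have -> : M%:E * P bad = \int[P]_x (M%:E * (\1_bad x)%:E).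
    rewrite ge0_integralZl//; last exact/measurable_EFinP/measurable_indic.
    by rewrite integral_indic// setIT.
  have mb : measurable_fun setT (fun x => M%:E * (\1_bad x)%:E).
    by apply: measurable_funeM; exact/measurable_EFinP/measurable_indic.
  rewrite -ge0_integralD//; last 3 first.
  - by move=> x _; rewrite lee_fin.
  - exact/measurable_EFinP.
  - by move=> x _; rewrite mule_ge0// lee_fin.
  apply: ge0_le_integral => //.
  + by move=> x _; rewrite lee_fin /T; case: ifP.
  + exact/measurable_EFinP.
  + by apply: emeasurable_funD => //; exact/measurable_EFinP.
  + move=> x _; rewrite -EFinM -EFinD lee_fin /T indicE.
    by case: (x \in bad); rewrite ?mulr1 ?mulr0 ?addr0// lerDr.
Qed.

(** At a level strictly above the essential infimum, conditioning has positive
probability for every [x], but this probability may be so small that the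
relative entropy is infinite. The points where it is below [expR (- k)] decrease
to the empty set, so for large [k] it is affordable not to condition there. *)
Lemma finite_entropy_above_ess_inf (D : R) :
  \int[P]_x ess_inf Q (fun y => (r (x, y))%:E) < D%:E ->
  exists K (V : probability (T1 * T2)%type R),
    [/\ forall E, measurable E -> V (fst @^-1` E) = P E,
        \int[V]_z (r z)%:E <= D%:E &
        relative_entropy V (P \x Q) <= K%:E].
Proof.
have M0 : (0 <= M)%R by have := r0 point; have := rM point; lra.
have QT : 0 < Q setT by rewrite [ltRHS](_ : _ = 1) ?lte01//; exact: probability_setT.
pose m x := fine (ess_inf Q (fun y => (r (x, y))%:E)).
have mE x : (m x)%:E = ess_inf Q (fun y => (r (x, y))%:E).
  rewrite fineK// fin_numElt; apply/andP; split.
    apply: (@lt_le_trans _ _ 0) => //.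
    by apply/ess_infP; apply: aeW => y; rewrite lee_fin.
  apply: (@le_lt_trans _ _ M%:E); last by rewrite ltry.
  rewrite -(ess_inf_cst M%:E QT); apply: le_ess_inf.
  by apply: aeW => y /=; rewrite lee_fin.
have m0 x : (0 <= m x)%R.
  by rewrite -lee_fin mE; apply/ess_infP; apply: aeW => y; rewrite lee_fin.
have mM x : (m x <= M)%R.
  rewrite -lee_fin mE -(ess_inf_cst M%:E QT); apply: le_ess_inf.
  by apply: aeW => y /=; rewrite lee_fin.
have mrx x : measurable_fun setT (fun y => r (x, y)).
  exact: (measurableT_comp mr (pair1_measurable x)).
(* [a <= m x] means that the superlevel set [a <= r (x, _)] has probability 1;
   it is a sublevel set of [- r]. *)
have mm : measurable_fun setT m.
  apply: (measurability _ (RGenCInfty.measurableE R)) => //.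
  move=> _ [_ [a ->] <-]; rewrite setTI.
  have mNr : measurable_fun setT (fun z => - r z)%R.
    exact: measurableT_comp.
  have mq := measurable_prob_sublevel Q mNr (measurable_cst (- a)%R).
  have := measurable_fun_eqr mq (measurable_cst (1%R : R)) measurableT (Y := [set true]).
  rewrite setTI => /(_ I); congr measurable; apply/seteqP; split => x /=.
    move=> /eqP; rewrite in_itv/= andbT => Q1.
    rewrite -lee_fin mE; apply/ess_infP.
    have mS : measurable [set y | (- r (x, y) <= - a)%R].
      exact: (measurable_sublevel mNr (cst (- a)%R)).
    exists (~` [set y | (- r (x, y) <= - a)%R]); split.
    - exact: measurableC.
    - rewrite [LHS](_ : _ = 1 - Q [set y | (- r (x, y) <= - a)%R]); last first.
        exact: probability_setC.
      rewrite -[X in 1 - X]fineK; last by rewrite fin_num_measure.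
      by rewrite Q1 subee.
    - by apply: subsetC => y /=; rewrite lee_fin lerN2.
  rewrite in_itv/= andbT -lee_fin mE => /ess_infP aer.
  have mS : measurable [set y | (- r (x, y) <= - a)%R].
    exact: (measurable_sublevel mNr (cst (- a)%R)).
  have : Q (~` [set y | (- r (x, y) <= - a)%R]) = 0.
    apply/negligibleP; first exact: measurableC.
    by apply: negligibleS aer => y /=; apply: contra_not; rewrite lee_fin lerN2.
  rewrite [LHS](_ : _ = 1 - Q [set y | (- r (x, y) <= - a)%R]); last first.
    exact: probability_setC.
  rewrite -[X in 1 - X]fineK; last by rewrite fin_num_measure.
  by rewrite -EFinB => -[] /eqP; rewrite subr_eq0 eq_sym.
under eq_integral do rewrite -mE.
have : \int[P]_x (m x)%:E <= M%:E.
  rewrite -(integral_probability_cst P M); apply: ge0_le_integral => //.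
  - by move=> x _; rewrite lee_fin.
  - exact/measurable_EFinP.
  - by move=> x _; rewrite lee_fin.
have : 0 <= \int[P]_x (m x)%:E by apply: integral_ge0 => x _; rewrite lee_fin.
case ia : (\int[P]_x (m x)%:E) => [a| |]//; rewrite !lee_fin lte_fin => a0 aM aD.
pose e := ((D - a) / 2)%R.
have e0 : (0 < e)%R by rewrite divr_gt0// subr_gt0.
pose t x := (m x + e)%R.
have mt : measurable_fun setT t by exact: measurable_funD.
have t0 x : (0 <= t x)%R by rewrite addr_ge0// ltW.
have Qt x : 0 < Q [set y | (r (x, y) <= t x)%R].
  rewrite lt0e measure_ge0 andbT; apply/eqP => Q0.
  have : (t x)%:E <= ess_inf Q (fun y => (r (x, y))%:E).
    apply/ess_infP; exists [set y | (r (x, y) <= t x)%R]; split => //.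
      exact: measurable_sublevel.
    by move=> y /=; rewrite lee_fin => /negP; rewrite -ltNge => /ltW.
  by rewrite -mE lee_fin /t gerDl leNgt e0.
pose bad k := [set x | Q [set y | (r (x, y) <= t x)%R] < (expR (- k%:R))%:E].
have mbad k : measurable (bad k) by exact: measurable_rare_sublevel.
have capbad : \bigcap_k bad k = set0.
  apply/seteqP; split => // x badx.
  have := Qt x; have := badx.
  have qfin : Q [set y | (r (x, y) <= t x)%R] \is a fin_num.
    by rewrite fin_num_measure//; exact: measurable_sublevel.
  rewrite -(fineK qfin) lte_fin; set q := fine _ => bq q0.
  have := bq (Num.trunc (- ln q)).+1 I; rewrite /bad /= -(fineK qfin) lte_fin -/q.
  apply/negP; rewrite -leNgt -[leRHS]lnK ?posrE// ler_expR lerNl.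
  by rewrite ltW// truncnS_gt.
have cvgbad : P \o bad @ \oo --> 0.
  rewrite -[0](_ : P (\bigcap_k bad k) = 0); last by rewrite capbad measure0.
  apply: nonincreasing_cvg_mu => //.
  - by rewrite -ge0_fin_numE// fin_num_measure.
  - by rewrite capbad.
  - apply/nonincreasing_seqP => k; apply/subsetPset => x; rewrite /bad /=.
    by move=> /lt_le_trans; apply; rewrite lee_fin ler_expR lerN2 ler_nat.
have [k Pk] : exists k, P (bad k) <= (e / (M + 1))%:E.
  have eM : (0 < e / (M + 1))%R by rewrite divr_gt0//; lra.
  have : \forall k \near \oo, P (bad k) < (e / (M + 1))%:E.
    by apply: (cvge_near_lt cvgbad); rewrite lte_fin.
  by move=> [k _ /(_ k (leqnn k)) /ltW ?]; exists k.
exists k%:R; apply: (@tilting_bounded t) => //.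
have -> : \int[P]_x (t x)%:E = (a + e)%:E.
  rewrite EFinD -ia -(integral_probability_cst P e) -ge0_integralD//.
  - by move=> x _; rewrite lee_fin.
  - exact/measurable_EFinP.
  - by move=> x _; rewrite lee_fin ltW.
apply: (@le_trans _ _ ((a + e)%:E + M%:E * (e / (M + 1))%:E)).
  by rewrite leeD2l// lee_wpmul2l// lee_fin.
rewrite -EFinM -EFinD lee_fin.
have : (M * (e / (M + 1)) <= e)%R.
  rewrite mulrCA mulrC -[leRHS]mul1r ler_wpM2r//; first exact: ltW.
  by rewrite ler_pdivrMr; lra.
by rewrite /e; lra.
Qed.

(** Duality bound for couplings with first marginal [P]: the variational
inequality is applied to [l * r (x, y) - c * \1_G x]. This function has
exponential moment at most 1: on [G] by the assumed Laplace bound, and off [G]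
because [l * r <= 0]. Confining the Laplace bound to [G] makes it possible to
use estimates that hold only with high probability in [x]. *)
Lemma relative_entropy_ge_laplace (V : probability (T1 * T2)%type R)
    (l c D : R) (G : set T1) :
  (forall E, measurable E -> V (fst @^-1` E) = P E) ->
  \int[V]_z (r z)%:E <= D%:E -> (l <= 0)%R -> measurable G ->
  (forall x, G x -> \int[Q]_y (expR (l * r (x, y)))%:E <= (expR c)%:E) ->
  (l * D)%:E - c%:E * P G <= relative_entropy V (P \x Q).
Proof.
move=> VP VD l0 mG Gc.
have M0 : (0 <= M)%R by have := r0 point; have := rM point; lra.
pose phi z := (l * r z - c * \1_G z.1)%R.
have mlr : measurable_fun setT (fun z => l * r z)%R by exact: measurable_funM.
have indicG : (fun z : T1 * T2 => \1_G z.1 : R) = \1_(fst @^-1` G).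
  by apply/funext => z; rewrite !indicE.
have mGf : measurable_fun setT (fun z : T1 * T2 => \1_G z.1 : R).
  rewrite indicG; apply: measurable_indic.
  by rewrite -[fst @^-1` G]setTI; exact: measurable_fst.
have mcG : measurable_fun setT (fun z : T1 * T2 => c * \1_G z.1)%R.
  exact: measurable_funM.
have mphi : measurable_fun setT phi by exact: measurable_funB.
have phib z : (`|phi z| <= `|l| * M + `|c|)%R.
  rewrite (le_trans (ler_normB _ _))// lerD// normrM.
    by rewrite ler_wpM2l// ger0_norm.
  by rewrite indicE; case: (_ \in _); rewrite ?normr1 ?mulr1// normr0 mulr0.
have int1 : \int[P \x Q]_z (expR (phi z))%:E <= 1.
  have mexp : measurable_fun setT (fun z => (expR (phi z))%:E).
    by apply/measurable_EFinP; exact: (measurableT_comp (@measurable_expR R)).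
  have exp0 z : 0 <= (expR (phi z))%:E by rewrite lee_fin expR_ge0.
  rewrite (fubini_tonelli1 _ mexp exp0).
  rewrite -(integral_probability_cst P 1); apply: ge0_le_integral => //.
  - by move=> x _; apply: integral_ge0 => y _; rewrite lee_fin expR_ge0.
  - exact: measurable_fun_fubini_tonelli_F.
  move=> x _; rewrite /fubini_F /phi/= indicE.
  have mrx : measurable_fun setT (fun y => expR (l * r (x, y))).
    apply: (measurableT_comp (@measurable_expR R)); apply: measurable_funM => //.
    exact: (measurableT_comp mr (pair1_measurable x)).
  have [xG|xG] := boolP (x \in G); last first.
    rewrite (eq_integral (fun y => (expR (l * r (x, y)))%:E)); last first.
      by move=> y _; rewrite mulr0 subr0.
    apply: (@le_trans _ _ (\int[Q]_y 1%:E)); last by rewrite integral_probability_cst.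
    apply: ge0_le_integral => //.
    - exact/measurable_EFinP.
    - by move=> y _; rewrite lee_fin -expR0 ler_expR mulr_le0_ge0.
  rewrite (eq_integral (fun y => (expR (- c))%:E * (expR (l * r (x, y)))%:E)); last first.
    by move=> y _; rewrite mulr1 expRD EFinM muleC.
  rewrite ge0_integralZl//; last exact/measurable_EFinP.
  apply: (@le_trans _ _ ((expR (- c))%:E * (expR c)%:E)).
    rewrite lee_wpmul2l ?lee_fin ?expR_ge0//; apply: Gc; exact: set_mem.
  by rewrite -EFinM -expRD addNr expR0.
apply: le_trans (relative_entropy_ge V mphi phib int1).
have VT : V setT < +oo by rewrite -ge0_fin_numE// fin_num_measure.
have ir : V.-integrable setT (EFin \o r).
  apply: measurable_bounded_integrable => //; exists M; split; first exact: num_real.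
  by move=> y My z _ /=; rewrite ger0_norm// (le_trans (rM z))// ltW.
have iG : V.-integrable setT (EFin \o (fun z : T1 * T2 => \1_G z.1)%R).
  apply: measurable_bounded_integrable => //; exists 1%R; split; first exact: num_real.
  move=> y y1 z _ /=; rewrite indicE; case: (_ \in _); rewrite ?normr1 ?normr0 ?ltW//.
  by rewrite (lt_trans _ y1).
rewrite /phi; under eq_integral do rewrite EFinB !EFinM.
rewrite integralB//=; last 2 first.
- exact: integrableZl.
- exact: integrableZl.
rewrite !integralZl//.
have -> : \int[V]_z (\1_G z.1)%:E = P G.
  rewrite -VP// (eq_integral (fun z => (\1_(fst @^-1` G) z)%:E)); last first.
    by move=> z _; rewrite -indicG.
  rewrite integral_indic ?setIT//.
  by rewrite -[fst @^-1` G]setTI; exact: measurable_fst.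
have rfin : \int[V]_z (r z)%:E \is a fin_num.
  exact: (integrable_fin_num measurableT ir).
apply: leeB => //; move: VD; rewrite -(fineK rfin) -EFinM !lee_fin => VD.
by rewrite ler_wnM2l.
Qed.

End tilting_bounded.

(** * The block distortion *)

Section block_distortion.
Context {R : realType} {dA dB : measure_display}.
Context {A : measurableType dA} {B : measurableType dB}.
Variables (d : nat) (rho : A * B -> R).

(** The sites of the cube are enumerated by the maps from the coordinates to
['I_n], so that the sum over a set of sites becomes a sum over a finite type of
cardinality [n ^ d]. *)
Lemma cube_site_subproof n (f : {ffun 'I_d -> 'I_n}) :
  (\row_j (f j).+1%:Z) \in cube d n.
Proof. by apply: mem_set => j; rewrite mxE !lez_nat ltn_ord. Qed.

Definition cube_site n (f : {ffun 'I_d -> 'I_n}) : cube d n :=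
  SigSub (cube_site_subproof f).

Lemma cube_site_bij n : bijective (@cube_site n).
Proof.
rewrite -setTT_bijective; split => // [f g _ _ /(congr1 val) /= /matrixP fg|u _].
  apply/ffunP => j; apply/val_inj; have := fg 0 j.
  by rewrite !mxE => -[].
have uP j : exists i : 'I_n, val u 0 j = i.+1%:Z.
  have /andP[] := set_mem (valP u) j; case: (val u 0 j) => // -[//|k] _ kn.
  by have kn' : (k < n)%N by []; exists (Ordinal kn').
have [g gE] := choice uP; exists [ffun j => g j] => //; apply/val_inj => /=.
by apply/rowP => j; rewrite !mxE ffunE gE.
Qed.

Lemma rho_nE n (x : conf (cube d n) A) (y : conf (cube d n) B) :
  rho_n rho x y = (n ^ d)%:R^-1 *
    \sum_(f : {ffun 'I_d -> 'I_n}) rho (x (cube_site f), y (cube_site f)).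
Proof.
rewrite /rho_n; congr (_ * _).
rewrite (reindex_fsbigT (@cube_site n)); last exact: cube_site_bij.
rewrite [RHS]bigfs ?index_enum_uniq//; last by move=> i _; rewrite mem_index_enum.
by apply: eq_fsbigl; apply/seteqP; split.
Qed.

Lemma measurable_rho_n n : measurable_fun setT rho ->
  measurable_fun setT
    (fun z : conf (cube d n) A * conf (cube d n) B => rho_n rho z.1 z.2).
Proof.
move=> mrho; apply: (eq_measurable_fun
  (fun z : conf (cube d n) A * conf (cube d n) B => (n ^ d)%:R^-1 *
    \sum_(f : {ffun 'I_d -> 'I_n}) rho (z.1 (cube_site f), z.2 (cube_site f)))).
  by move=> z _; rewrite rho_nE.
apply: measurable_funM => //; apply: measurable_sum => f.
have mcoord (dT : measure_display) (T : measurableType dT) (u : cube d n) :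
    measurable_fun setT (fun x : conf (cube d n) T => x u).
  move=> _ E mE; rewrite setTI; apply: sub_sigma_algebra.
  by exists u => //; exists E => //; rewrite setTI.
apply: (measurableT_comp mrho); apply: measurable_fun_pair.
  exact: (measurableT_comp (mcoord _ _ _) measurable_fst).
exact: (measurableT_comp (mcoord _ _ _) measurable_snd).
Qed.

Lemma rho_n_ge0 n x y : (forall z, 0 <= rho z) -> 0 <= @rho_n R _ _ A B d rho n x y.
Proof. by move=> r0; rewrite rho_nE mulr_ge0// sumr_ge0. Qed.

Lemma rho_n_le n x y M : 0 <= M -> (forall z, rho z <= M) ->
  @rho_n R _ _ A B d rho n x y <= M.
Proof.
move=> M0 rM; rewrite rho_nE.
have [nd0|nd0] := eqVneq (n ^ d)%N 0%N; first by rewrite nd0 invr0 mul0r.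
rewrite mulrC ler_pdivrMr ?ltr0n ?lt0n//.
apply: (@le_trans _ _ (\sum_(f : {ffun 'I_d -> 'I_n}) M)); first exact: ler_sum.
by rewrite sumr_const card_ffun !card_ord mulr_natr.
Qed.

End block_distortion.

(** * From ball probabilities to bounds on R_n *)

Section eventual_probability.
Context {d : measure_display} {T : measurableType d} {R : realType}.
Local Open Scope ereal_scope.

(** Almost sure eventual occurrence implies convergence in probability: the
sets where some event of index at least [k] fails decrease to a null set. *)
Lemma probability_eventually (P : probability T R) (E : (set T)^nat) (e : R) :
  (forall n, measurable (E n)) -> {ae P, forall x, \forall n \near \oo, E n x} ->
  (0 < e)%R -> \forall n \near \oo, P (~` E n) < e%:E.
Proof.
move=> mE [N [mN PN0 EN]] e0.
pose F k := \bigcup_(n in [set n | (k <= n)%N]) ~` E n.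
have mF k : measurable (F k) by apply: bigcup_measurable => n _; exact: measurableC.
have mcF : measurable (\bigcap_k F k) by exact: bigcapT_measurable.
have F0 : P (\bigcap_k F k) = 0.
  apply/eqP; rewrite eq_le measure_ge0 andbT -PN0; apply: le_measure; rewrite ?inE//.
  move=> x Fx; apply: EN => /= -[k _ kE].
  by have [n /= kn] := Fx k I; apply; exact: kE.
have PF : P \o F @ \oo --> 0.
  rewrite -F0; apply: nonincreasing_cvg_mu => //.
    by rewrite -ge0_fin_numE// fin_num_measure.
  apply/nonincreasing_seqP => k; apply/subsetPset => x [n /= kn nE].
  by exists n => //=; exact: ltnW.
have := cvge_near_lt PF (_ : 0 < e%:E); rewrite lte_fin => /(_ e0).
apply: filterS => k; apply: le_lt_trans; apply: le_measure; rewrite ?inE//.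
  exact: measurableC.
by move=> x nE; exists k => /=.
Qed.

End eventual_probability.

Section laplace.
Context {d : measure_display} {T : measurableType d} {R : realType}.
Local Open Scope ereal_scope.

(** Cut the range of [f] into [K] intervals of length [delta]. Since [l <= 0],
on [[k * delta, (k + 1) * delta]] the exponential is largest at the left end,
and this interval is contained in the sublevel set of its right end. *)
Lemma laplace_le_grid (Q : probability T R) (f : T -> R) (l delta : R) (K : nat) :
  measurable_fun setT f -> (forall y, 0 <= f y)%R ->
  (l <= 0)%R -> (0 < delta)%R -> (forall y, f y < K%:R * delta)%R ->
  \int[Q]_y (expR (l * f y))%:E <=
  \sum_(k < K) (expR (l * (k%:R * delta)))%:E * Q [set y | (f y <= k.+1%:R * delta)%R].
Proof.
move=> mf f0 l0 delta0 fK.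
have mS k : measurable [set y | (f y <= k.+1%:R * delta)%R].
  rewrite -[X in measurable X]setTI.
  exact: (measurable_fun_ler mf (measurable_cst _) measurableT (Y := [set true])).
have mk k : measurable_fun setT (fun y => (expR (l * (k%:R * delta)))%:E *
    (\1_[set y | (f y <= k.+1%:R * delta)%R] y)%:E).
  by apply: measurable_funeM; apply/measurable_EFinP; exact: measurable_indic.
have k0 k y : 0 <= (expR (l * (k%:R * delta)))%:E *
    (\1_[set y | (f y <= k.+1%:R * delta)%R] y)%:E.
  by rewrite mule_ge0// lee_fin expR_ge0.
rewrite (eq_bigr (fun k : 'I_K => \int[Q]_y ((expR (l * (k%:R * delta)))%:E *
    (\1_[set y | (f y <= k.+1%:R * delta)%R] y)%:E))); last first.
  move=> k _; rewrite ge0_integralZl//.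
    by rewrite integral_indic// setIT.
  by apply/measurable_EFinP; exact: measurable_indic.
rewrite -ge0_integral_sum//; apply: ge0_le_integral => //.
- apply/measurable_EFinP/(measurableT_comp (@measurable_expR R)).
  exact: measurable_funM.
- exact: emeasurable_sum.
move=> y _.
have fd0 : (0 <= f y / delta)%R by rewrite divr_ge0// ltW.
have /andP[] := truncn_itv fd0; set k := Num.trunc _.
rewrite ler_pdivlMr// ltr_pdivrMr// => kf fk.
have kK : (k < K)%N.
  by rewrite -(ltr_nat R) -(ltr_pM2r delta0) (le_lt_trans kf).
rewrite (bigD1 (Ordinal kK))//= indicE mem_set ?mule1; last exact/ltW.
apply: (@le_trans _ _ (expR (l * (k%:R * delta)))%:E).
  by rewrite lee_fin ler_expR ler_wnM2l.
by rewrite leeDl// sume_ge0// => i _; exact: k0.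
Qed.

End laplace.

Section block_bounds.
Context {R : realType} {dA dB : measure_display}.
Context {A : measurableType dA} {B : measurableType dB}.
Variables (d : nat) (rho : A * B -> R) (mrho : measurable_fun setT rho).
Hypothesis rho0 : forall z, 0 <= rho z.
Variables (M : R) (rhoM : forall z, rho z <= M).
Local Notation Zd := 'rV[int]_d.
Variables (P : probability (conf Zd A) R) (Q : probability (conf Zd B) R).
Local Open Scope ereal_scope.

Local Notation P_ n := (marginal P (cube d n)).
Local Notation Q_ n := (marginal Q (cube d n)).
Local Notation N n := ((n ^ d)%:R : R).

Let M0 : (0 <= M)%R.
Proof. by have := rho0 point; have := rhoM point; lra. Qed.

Let r0 n (z : conf (cube d n) A * conf (cube d n) B) : (0 <= rho_n rho z.1 z.2)%R.
Proof. exact: rho_n_ge0. Qed.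

Let rM n (z : conf (cube d n) A * conf (cube d n) B) : (rho_n rho z.1 z.2 <= M)%R.
Proof. exact: rho_n_le. Qed.

Let N0 n : (0 < n)%N -> (0 < N n)%R.
Proof. by move=> n0; rewrite ltr0n expn_gt0 n0. Qed.

Lemma R_seq_le (D : R) n K
    (V : probability (conf (cube d n) A * conf (cube d n) B)%type R) :
  (0 < n)%N -> (forall E, measurable E -> V (fst @^-1` E) = P_ n E) ->
  \int[V]_z (rho_n rho z.1 z.2)%:E <= D%:E ->
  relative_entropy V (P_ n \x Q_ n) <= (N n * K)%:E ->
  R_seq rho P Q D n <= K%:E.
Proof.
move=> n0 VP VD VK.
apply: (@le_trans _ _ ((N n)^-1%:E * relative_entropy V (P_ n \x Q_ n))).
  by apply: ereal_inf_lbound; exists V.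
apply: (@le_trans _ _ ((N n)^-1%:E * (N n * K)%:E)).
  by rewrite lee_wpmul2l// lee_fin invr_ge0.
by rewrite -EFinM mulKf// gt_eqF// N0.
Qed.

Lemma R_seq_lty (D : R) n : (0 < n)%N -> D_min_n rho P Q n < D%:E ->
  R_seq rho P Q D n < +oo.
Proof.
move=> n0 Dmin.
have [K [V [VP VD VK]]] :=
  finite_entropy_above_ess_inf (measurable_rho_n mrho) (@r0 n) (@rM n) Dmin.
apply: (@le_lt_trans _ _ ((N n)^-1 * K)%:E); last exact: ltry.
by apply: (R_seq_le n0 VP VD); rewrite mulVKf// gt_eqF// N0.
Qed.

Lemma R_seq_ge_laplace (D l c : R) n (G : set (conf (cube d n) A)) :
  (0 < n)%N -> (l <= 0)%R -> measurable G ->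
  (forall x, G x ->
     \int[Q_ n]_y (expR (N n * l * rho_n rho x y))%:E <= (expR (N n * c))%:E) ->
  (l * D)%:E - c%:E * P_ n G <= R_seq rho P Q D n.
Proof.
move=> n0 l0 mG Gc; apply: le_ereal_inf_tmp => _ [V [VP VD] <-].
have l0' : (N n * l <= 0)%R by rewrite mulr_ge0_le0// ltW// N0.
have := relative_entropy_ge_laplace (measurable_rho_n mrho) (@r0 n) (@rM n)
  VP VD l0' mG Gc.
have PGfin : P_ n G \is a fin_num by rewrite fin_num_measure.
rewrite -(fineK PGfin) -!EFinM -!EFinB => H.
apply: (@le_trans _ _ ((N n)^-1%:E * (N n * l * D - N n * c * fine (P_ n G))%:E)).
  rewrite -EFinM lee_fin -!mulrA -mulrBr mulKf// gt_eqF// N0//.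
by rewrite lee_wpmul2l// lee_fin invr_ge0.
Qed.

Lemma measurable_ball_prob (t : R) n :
  measurable_fun setT (fun x => fine (Q_ n (distortion_ball rho x t))).
Proof.
exact: (measurable_prob_sublevel (Q_ n) (measurable_rho_n mrho) (measurable_cst t)).
Qed.

Lemma measurable_ball (t : R) n (x : conf (cube d n) A) :
  measurable (distortion_ball rho x t).
Proof. exact: (measurable_sublevel (measurable_rho_n mrho) (cst t)). Qed.

Lemma ball_prob_fin_num (t : R) n (x : conf (cube d n) A) :
  Q_ n (distortion_ball rho x t) \is a fin_num.
Proof. by rewrite fin_num_measure//; exact: measurable_ball. Qed.

(** Upper half of the identification: lower bounds on ball probabilities turn
into couplings. The gap [D - D'] pays for the blocks with too small a
ball probability, whose probability tends to 0. *)
Lemma R_seq_le_eventually (D D' b : R) : (0 <= D' < D)%R -> (0 <= b)%R ->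
  {ae P, forall x, \forall n \near \oo,
    (expR (- (N n * b)))%:E <= Q_ n (distortion_ball rho (restr (cube d n) x) D')} ->
  \forall n \near \oo, R_seq rho P Q D n <= b%:E.
Proof.
move=> /andP[D'0 D'D] b0 aeb.
pose S n := [set x : conf (cube d n) A |
  (expR (- (N n * b)))%:E <= Q_ n (distortion_ball rho x D')].
have mS n : measurable (S n).
  have := measurable_fun_ler (measurable_cst (expR (- (N n * b))))
    (@measurable_ball_prob D' n) measurableT (Y := [set true]).
  rewrite setTI => /(_ Logic.I); congr measurable; apply/seteqP; split => x /=;
    by rewrite /S/= -lee_fin fineK// ball_prob_fin_num.
have mE n : measurable (restr (cube d n) @^-1` S n).
  by rewrite -[X in measurable X]setTI; exact: measurable_funPT.
have M1 : (0 < M + 1)%R by rewrite ltr_wpDl.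
have e0 : (0 < (D - D') / (M + 1))%R by rewrite divr_gt0// subr_gt0.
have := probability_eventually mE aeb e0.
apply: filterS2 (nbhs_infty_gt 0) => n n0 PE.
have [|V [VP VD VK]] := @tilting_bounded _ _ _ _ _ (P_ n) (Q_ n) _
    (measurable_rho_n mrho) (@r0 n) M (@rM n) (cst D') (N n * b) D
    (measurable_cst D') (fun=> D'0) (mulr_ge0 (ltW (N0 n0)) b0).
  rewrite integral_probability_cst.
  rewrite [X in M%:E * P_ n X](_ : _ = ~` S n); last first.
    by apply/seteqP; split => x; rewrite /S/= ltNge => /negP.
  have -> : P_ n (~` S n) = P (~` (restr (cube d n) @^-1` S n)) by [].
  apply: (@le_trans _ _ (D'%:E + M%:E * ((D - D') / (M + 1))%:E)).
    by rewrite leeD2l// lee_wpmul2l// ?lee_fin// ltW.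
  rewrite -EFinM -EFinD lee_fin -lerBrDl mulrCA ler_piMr//; first lra.
  by rewrite ler_pdivrMr; lra.
exact: R_seq_le n0 VP VD VK.
Qed.

(** Lower half of the identification: affine upper bounds on the exponents of
the ball probabilities turn into a lower bound for [R_n]. The four multiples of
[e] lost are: one from the hypothesis, one from the width of the
grid, one from the number of its points, and one from the blocks where the
estimates fail. *)
Lemma R_seq_ge_eventually (D l j e : R) : (0 < d)%N -> (l <= 0)%R -> (0 < e)%R ->
  (forall t, {ae P, forall x, \forall n \near \oo,
    Q_ n (distortion_ball rho (restr (cube d n) x) t) <=
      (expR (- (N n * (j + l * (t - D) - e))))%:E}) ->
  \forall n \near \oo, (j - 4 * e)%:E <= R_seq rho P Q D n.
Proof.
move=> d0 l0 e0 aeb.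
(* The mesh [(M + 1) / K] makes [- l * delta <= e]; using [M + 1] instead of
   [M] keeps the distortion strictly below the end of the grid. *)
pose K := (Num.trunc (- l * (M + 1) / e)).+1.
have K0 : (0 < K%:R :> R)%R by rewrite ltr0n.
pose delta := ((M + 1) / K%:R)%R.
have delta0 : (0 < delta)%R by rewrite divr_gt0; have := M0; lra.
have Kdelta : (K%:R * delta = M + 1)%R by rewrite mulrCA divff ?mulr1// gt_eqF.
have ldelta : (- l * delta <= e)%R.
  rewrite /delta mulrA ler_pdivrMr// [leRHS]mulrC -ler_pdivrMr// ltW//.
  exact: truncnS_gt.
pose c := (l * D - j + 3 * e)%R.
pose S n := \bigcap_(k in [set k | (k < K)%N]) [set x : conf (cube d n) A |
  Q_ n (distortion_ball rho x (k.+1%:R * delta)) <=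
    (expR (- (N n * (j + l * (k.+1%:R * delta - D) - e))))%:E].
have mS n : measurable (S n).
  apply: bigcap_measurable => [|k _]; first by exists 0%N.
  have := measurable_fun_ler (@measurable_ball_prob (k.+1%:R * delta) n)
    (measurable_cst (expR (- (N n * (j + l * (k.+1%:R * delta - D) - e)))))
    measurableT (Y := [set true]).
  rewrite setTI => /(_ Logic.I); congr measurable; apply/seteqP; split => x /=;
    by rewrite -lee_fin fineK// ball_prob_fin_num.
have mE n : measurable (restr (cube d n) @^-1` S n).
  by rewrite -[X in measurable X]setTI; exact: measurable_funPT.
have aeS : {ae P, forall x, \forall n \near \oo, (restr (cube d n) @^-1` S n) x}.
  have := ae_foralln (fun k => aeb (k.+1%:R * delta)%R).
  apply: filterS => x Hx.
  suff : \forall n \near \oo, forall k : 'I_K,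
      Q_ n (distortion_ball rho (restr (cube d n) x) (k.+1%:R * delta)) <=
      (expR (- (N n * (j + l * (k.+1%:R * delta - D) - e))))%:E.
    by apply: filterS => n Hn k /= kK; exact: (Hn (Ordinal kK)).
  by apply: filter_forall => k; exact: Hx.
have e0' : (0 < e / (`|c| + 1))%R by rewrite divr_gt0// ltr_wpDl.
have Nlarge : \forall n \near \oo, (K%:R <= expR (N n * e))%R.
  near=> n; apply: le_trans (expR_ge1Dx _); rewrite (@le_trans _ _ (N n * e)%R) ?lerDr//.
  rewrite -ler_pdivrMr// (@le_trans _ _ n%:R)//; last first.
    by rewrite ler_nat -[X in (X <= _)%N]expn1 leq_pexp2l//; near: n; exact: nbhs_infty_gt.
  near: n; exact: nbhs_infty_ger.
have := probability_eventually mE aeS e0'.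
apply: filterS3 (nbhs_infty_gt 0) Nlarge => n n0 KN PE.
have Gc x : S n x ->
    \int[Q_ n]_y (expR (N n * l * rho_n rho x y))%:E <= (expR (N n * c))%:E.
  move=> Sx.
  have mr : measurable_fun setT (fun y => rho_n rho x y).
    exact: (measurable_fun_pair2 x (measurable_rho_n mrho)).
  have Nl0 : (N n * l <= 0)%R by rewrite mulr_ge0_le0// ltW// N0.
  have rK y : (rho_n rho x y < K%:R * delta)%R.
    by rewrite Kdelta; have := @rM n (x, y); rewrite /=; lra.
  apply: le_trans (laplace_le_grid (Q_ n) mr (fun y => @r0 n (x, y)) Nl0 delta0 rK) _.
  apply: (@le_trans _ _ (\sum_(k < K) (expR (N n * (c - e)))%:E)).
    apply: lee_sum => k _.
    apply: (@le_trans _ _ ((expR (N n * l * (k%:R * delta)))%:E *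
      (expR (- (N n * (j + l * (k.+1%:R * delta - D) - e))))%:E)).
      by rewrite lee_wpmul2l ?lee_fin ?expR_ge0//; exact: (Sx k (ltn_ord k)).
    rewrite -EFinM -expRD lee_fin ler_expR -mulrA -mulrN -mulrDr ler_pM2l ?N0//.
    (* The left end of an interval in the exponential and the right end in the
       ball probability differ by [delta]; all other terms in [k] cancel. *)
    rewrite /c -natr1; move: ldelta; nra.
  rewrite sumEFin lee_fin sumr_const card_ord -[X in (X <= _)%R]mulr_natl.
  apply: (@le_trans _ _ (expR (N n * e) * expR (N n * (c - e)))%R).
    by rewrite ler_wpM2r ?expR_ge0.
  by rewrite -expRD -mulrDr addrC subrK.
apply: le_trans (R_seq_ge_laplace D n0 l0 (mS n) Gc).
have Pfin : P (~` (restr (cube d n) @^-1` S n)) \is a fin_num.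
  by rewrite fin_num_measure//; exact: measurableC.
have -> : P_ n (S n) = 1 - P (~` (restr (cube d n) @^-1` S n)).
  rewrite (_ : P_ n (S n) = P (restr (cube d n) @^-1` S n))//.
  rewrite (_ : P (~` _) = 1 - P (restr (cube d n) @^-1` S n)); last exact: probability_setC.
  have PWfin : P (restr (cube d n) @^-1` S n) \is a fin_num by rewrite fin_num_measure.
  by rewrite -(fineK PWfin) -!EFinB; congr EFin; lra.
move: PE; rewrite -(fineK Pfin) lte_fin; set p := fine _ => pe.
have p0 : (0 <= p)%R by rewrite fine_ge0.
rewrite -EFinB lee_fin.
have : (- c * p <= e)%R.
  apply: (@le_trans _ _ (`|c| * (e / (`|c| + 1)))%R).
    rewrite (@le_trans _ _ (`|c| * p)%R)//; last by rewrite ler_wpM2l// ltW.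
    by rewrite ler_wpM2r// -normrN ler_norm.
  rewrite mulrCA ler_piMr//; first exact: ltW.
  by rewrite ler_pdivrMr ?mul1r ?lerDl ?ltr_wpDl.
rewrite /c; lra.
Unshelve. all: by end_near.
Qed.

End block_bounds.

(** * Large deviations on half-lines and convex rate functions *)

Section half_lines.
Context {d : measure_display} {T : measurableType d} {R : realType}.
Variables (Pr : probability T R) (Z : nat -> T -> R) (s : nat -> R) (I : R -> \bar R).
Hypothesis ldp : LDP Pr Z s I.
Local Open Scope ereal_scope.

Lemma le_expR_lne (c a : R) (p : \bar R) : (0 < c)%R ->
  c^-1%:E * lne p < a%:E -> p <= (expR (c * a))%:E.
Proof.
move=> c0; have ci0 : (0 < c^-1)%R by rewrite invr_gt0.
case: p => [r| |]; last by rewrite leNye.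
- have [r0 _|r0] := leP r 0%R; first by rewrite lee_fin (le_trans r0)// expR_ge0.
  rewrite lne_EFin// -EFinM lte_fin mulrC ltr_pdivrMr// mulrC => H.
  by rewrite lee_fin -[leLHS]lnK ?posrE// ler_expR ltW.
- by rewrite /= gt0_muley ?lte_fin.
Qed.

Lemma expR_le_lne (c a : R) (p : \bar R) : (0 < c)%R ->
  a%:E < c^-1%:E * lne p -> (expR (c * a))%:E <= p.
Proof.
move=> c0; have ci0 : (0 < c^-1)%R by rewrite invr_gt0.
case: p => [r| |]; last by rewrite /= gt0_muleNy ?lte_fin.
- have [r0|r0] := leP r 0%R; first by rewrite le0_lneNy ?lee_fin// gt0_muleNy ?lte_fin.
  rewrite lne_EFin// -EFinM lte_fin mulrC ltr_pdivlMr// mulrC => H.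
  by rewrite lee_fin -[leRHS]lnK ?posrE// ler_expR ltW.
- by rewrite leey.
Qed.

Lemma measurable_half_line (t : R) : measurable [set z : R | (z <= t)%R].
Proof. by rewrite -set_itvNyc; exact: measurable_itv. Qed.

(** On the closed half-line the upper bound sees [z <= t], whereas the lower
bound, which is over the interior, only sees [z < t]. *)
Lemma ldp_half_line_esup (t : R) (L : \bar R) : (forall z, (z <= t)%R -> L <= I z) ->
  limn_esup (fun n => (s n)^-1%:E * lne (Pr (Z n @^-1` [set z | (z <= t)%R]))) <= - L.
Proof.
move=> LI; have [_ /(_ _ (measurable_half_line t))[_ /le_trans]] := ldp; apply.
rewrite leeN2; apply: le_ereal_inf_tmp => _ [z zt <-]; apply: LI.
have /closure_id ct : closed [set z : R | (z <= t)%R] by exact: closed_le.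
by move: zt; rewrite -ct.
Qed.

Lemma ldp_half_line_einf (t : R) (L : \bar R) :
  ereal_inf (I @` [set z | (z < t)%R]) <= L ->
  - L <= limn_einf (fun n => (s n)^-1%:E * lne (Pr (Z n @^-1` [set z | (z <= t)%R]))).
Proof.
move=> LI; have [_ /(_ _ (measurable_half_line t))[+ _]] := ldp; apply: le_trans.
rewrite leeN2; apply: le_trans LI; apply: ereal_inf_le_tmp; apply: image_subset.
rewrite -open_subsetE; last exact: open_lt.
by move=> z /ltW.
Qed.

Hypothesis s0 : \forall n \near \oo, (0 < s n)%R.

Lemma ldp_half_line_le (t b e : R) : (0 < e)%R ->
  (forall z, (z <= t)%R -> b%:E <= I z) ->
  \forall n \near \oo,
    Pr (Z n @^-1` [set z | (z <= t)%R]) <= (expR (- (s n * (b - e))))%:E.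
Proof.
move=> e0 /ldp_half_line_esup bI.
have : limn_esup (fun n => (s n)^-1%:E * lne (Pr (Z n @^-1` [set z | (z <= t)%R]))) <
    (- (b - e))%:E.
  by apply: le_lt_trans bI _; rewrite lte_fin ltrN2; lra.
move=> /limn_esup_near_lt; apply: filterS2 s0 => n sn0 /(le_expR_lne sn0).
by rewrite mulrN.
Qed.

Lemma ldp_half_line_ge (t z b : R) : (z < t)%R -> I z < b%:E ->
  \forall n \near \oo,
    (expR (- (s n * b)))%:E <= Pr (Z n @^-1` [set z | (z <= t)%R]).
Proof.
move=> zt Izb.
have /ldp_half_line_einf H : ereal_inf (I @` [set z | (z < t)%R]) <= I z.
  by apply: ereal_inf_lbound; exists z.
have : (- b)%:E < limn_einf (fun n => (s n)^-1%:E * lne (Pr (Z n @^-1` [set z | (z <= t)%R]))).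
  by apply: lt_le_trans H; rewrite EFinN lteN2.
move=> /limn_einf_near_gt; apply: filterS2 s0 => n sn0 /(expR_le_lne sn0).
by rewrite mulrN.
Qed.

(** Nonnegative variables never visit the open half-line, so the lower bound of
the large deviations principle forces the rate to be infinite there. *)
Lemma rate_lt0 (z : R) : (forall n w, 0 <= Z n w)%R -> (z < 0)%R -> I z = +oo.
Proof.
move=> Z0 z0; case Iz : (I z) => [u|//|]; last first.
  by have [[/(_ z)]] := ldp; rewrite Iz.
have z2 : (z < z / 2)%R by lra.
have : I z < (u + 1)%:E by rewrite Iz lte_fin ltrDl.
move=> /(ldp_half_line_ge z2)[n _ /(_ n (leqnn n))].
rewrite [X in Pr X](_ : _ = set0) ?measure0 ?lee_fin ?leNgt ?expR_gt0//.
apply/seteqP; split => // w /=; apply/negP; rewrite -ltNge.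
by apply: lt_le_trans (Z0 n w); lra.
Qed.

End half_lines.

Section convex_rate.
Context {R : realType}.
Variables (I : R -> \bar R).
Local Open Scope ereal_scope.
Hypotheses (I0 : forall z, 0 <= I z) (cI : convex_ereal I).

(** Only the end point [D] needs attention: along the segment from [D] to the
point [z0] where [I] is finite, convexity bounds [I] by values converging to
[I D]. *)
Lemma convex_inf_half_line (z0 D : R) : (z0 < D)%R -> I z0 < +oo ->
  ereal_inf (I @` [set z | (z < D)%R]) <= ereal_inf (I @` [set z | (z <= D)%R]).
Proof.
move=> z0D Iz0; apply: le_ereal_inf_tmp => _ [z /= + <-].
rewrite (le_eqVlt z) => /predU1P[->|zD]; last by apply: ereal_inf_lbound; exists z.
case ID : (I D) => [v| |]; [|by rewrite leey|by have := I0 D; rewrite ID].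
have [u Iu] : exists u, I z0 = u%:E.
  by case: (I z0) (I0 z0) Iz0 => // u _ _; exists u.
apply/lee_addgt0Pr => e e0; rewrite -EFinD.
(* Chosen so that moving from [D] towards [z0] by [t] costs at most [e]. *)
pose t := (e / (e + `|u - v|))%R.
have ne0 : (0 < e + `|u - v|)%R by rewrite ltr_pwDl.
have t0 : (0 < t)%R by rewrite divr_gt0.
have t1 : (t <= 1)%R by rewrite ler_pdivrMr// mul1r lerDl.
apply: (@le_trans _ _ (I (t * z0 + (1 - t) * D)%R)).
  apply: ereal_inf_lbound; exists (t * z0 + (1 - t) * D)%R => //=; nra.
apply: (le_trans (cI _ _ _)); first by rewrite (ltW t0).
rewrite Iu ID -!EFinM -EFinD lee_fin.
have : (t * (u - v) <= e)%R.
  apply: (@le_trans _ _ (t * `|u - v|)%R); first by rewrite ler_wpM2l ?ler_norm// ltW.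
  rewrite /t mulrAC ler_pdivrMr// ler_pM2l// lerDr ltW//.
lra.
Qed.

(** The slope is the opposite of the infimum of the quotients
[(I z - j) / (D - z)] over [z < D]. It is nonpositive because [j <= I] to the
left of [D]. To the right of [D] the line stays below [I], since a chord of [I]
across [D] passes above [I D], hence above [j]. *)
Lemma convex_subgradient (z0 D j : R) : (z0 < D)%R -> I z0 < +oo ->
  (forall z, (z <= D)%R -> j%:E <= I z) ->
  exists2 l : R, (l <= 0)%R & forall z, (j + l * (z - D))%:E <= I z.
Proof.
move=> z0D Iz0 jI.
have Ifin z : I z < +oo -> exists u, I z = u%:E.
  by case: (I z) (I0 z) => // u _ _; exists u.
pose S := [set m : R | exists z u, [/\ (z < D)%R, I z = u%:E & m = ((u - j) / (D - z))%R]].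
have S0 : lbound S 0%R.
  move=> _ [z [u [zD Iu ->]]]; apply: divr_ge0; rewrite subr_ge0; last exact: ltW.
  by have := jI z (ltW zD); rewrite Iu lee_fin.
have Sne : S !=set0.
  by have [u Iu] := Ifin _ Iz0; exists ((u - j) / (D - z0))%R, z0, u.
exists (- inf S)%R; first by rewrite oppr_le0; exact: lb_le_inf.
move=> z; case Iz : (I z) => [u| |]; [|by rewrite leey|by have := I0 z; rewrite Iz].
rewrite lee_fin; have [zD|zD|zD] := ltgtP z D.
- have : (inf S <= (u - j) / (D - z))%R.
    by apply: ge_inf; [exists 0%R|exists z, u].
  by rewrite ler_pdivlMr ?subr_gt0//; lra.
- have : ((j - u) / (z - D) <= inf S)%R.
    apply: lb_le_inf => // _ [z' [u' [z'D Iu' ->]]].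
    rewrite ler_pdivrMr ?subr_gt0// mulrAC ler_pdivlMr ?subr_gt0//.
    pose t := ((z - D) / (z - z'))%R.
    have zz' : (0 < z - z')%R by lra.
    have tz : (t * (z - z') = z - D)%R by rewrite /t divfK// gt_eqF.
    have t01 : (0 <= t <= 1)%R.
      by rewrite divr_ge0 ?ler_pdivrMr//=; lra.
    have DE : (t * z' + (1 - t) * z = D)%R by lra.
    have : j%:E <= t%:E * I z' + (1 - t)%:E * I z.
      by apply: le_trans (jI D (lexx D)) _; rewrite -DE; exact: cI.
    rewrite Iu' Iz -!EFinM -EFinD lee_fin => H.
    have : (j * (z - z') <= (t * u' + (1 - t) * u) * (z - z'))%R.
      by rewrite ler_wpM2r// ltW.
    rewrite (_ : (t * u' + (1 - t) * u) * (z - z') = (z - D) * u' + (D - z') * u)%R.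
      lra.
    by rewrite -tz (_ : D = z - t * (z - z'))%R; [ring|lra].
  by rewrite ler_pdivrMr ?subr_gt0//; lra.
- have : j%:E <= u%:E by rewrite -Iz; apply: jI; rewrite zD.
  by rewrite lee_fin zD subrr mulr0 addr0.
Qed.

End convex_rate.

(** * Identification of the limit *)

Section almost_everywhere.
Local Open Scope ereal_scope.

Lemma ae_distribution {d d' : measure_display} {T : measurableType d}
    {T' : measurableType d'} {R : realType} (P : probability T R)
    (f : {mfun T >-> T'}) (S : T' -> Prop) :
  {ae distribution P f, forall x, S x} -> {ae P, forall w, S (f w)}.
Proof.
move=> [N [mN PN0 SN]]; exists (f @^-1` N); split => //.
  by rewrite -[f @^-1` N]setTI; exact: measurable_funPT.
by move=> w nS; exact: SN.
Qed.

Lemma ae_exists {d : measure_display} {T : measurableType d} {R : realType}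
    (P : probability T R) (S : T -> Prop) : {ae P, forall x, S x} -> exists x, S x.
Proof.
move=> [N [mN PN0 SN]]; apply/not_existsP => nS.
have NT : N = setT by apply/seteqP; split => // x _; apply: SN; exact: nS.
have : P setT = 0 by rewrite -NT.
rewrite [LHS](_ : _ = 1); last exact: probability_setT.
by move/eqP; rewrite onee_eq0.
Qed.

End almost_everywhere.

Section asymptotics.
Context {R : realType} {dA dB dO : measure_display}.
Context {A : measurableType dA} {B : measurableType dB} {Omega : measurableType dO}.
Variables (d : nat) (d_gt0 : (0 < d)%N).
Variables (rho : A * B -> R) (mrho : measurable_fun setT rho).
Hypothesis rho0 : forall z, 0 <= rho z.
Variables (M : R) (rhoM : forall z, rho z <= M).
Local Notation Zd := 'rV[int]_d.
Variables (P : probability (conf Zd A) R) (Pr : probability Omega R).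
Variable Y : {RV Pr >-> conf Zd B}.
Variable I : R -> \bar R.
Local Open Scope ereal_scope.

Local Notation Q := (distribution Pr Y).
Local Notation Q_ n := (marginal Q (cube d n)).
Local Notation N n := ((n ^ d)%:R : R).

Hypothesis I_convex : convex_ereal I.
Hypothesis I_LDP : {ae P, forall x, LDP Pr
  (fun n w => rho_n rho (restr (cube d n) x) (restr (cube d n) (Y w)))
  (fun n => N n) I}.

Let N_gt0 : \forall n \near \oo, (0 < N n)%R.
Proof.
by apply: filterS (nbhs_infty_gt 0) => n n0; rewrite ltr0n expn_gt0 n0.
Qed.

Let I0 z : 0 <= I z.
Proof. by have [x [[I0 _] _]] := ae_exists I_LDP. Qed.

Let I_lt0 z : (z < 0)%R -> I z = +oo.
Proof.
have [x ldp] := ae_exists I_LDP; apply: (rate_lt0 ldp N_gt0) => n w.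
exact: rho_n_ge0.
Qed.

Lemma ball_prob_le (t b e : R) : (0 < e)%R -> (forall z, (z <= t)%R -> b%:E <= I z) ->
  {ae P, forall x, \forall n \near \oo,
    Q_ n (distortion_ball rho (restr (cube d n) x) t) <= (expR (- (N n * (b - e))))%:E}.
Proof.
by move=> e0 bI; apply: filterS I_LDP => x ldp; exact: (ldp_half_line_le ldp N_gt0 e0 bI).
Qed.

Lemma ball_prob_ge (t z b : R) : (z < t)%R -> I z < b%:E ->
  {ae P, forall x, \forall n \near \oo,
    (expR (- (N n * b)))%:E <= Q_ n (distortion_ball rho (restr (cube d n) x) t)}.
Proof.
by move=> zt Izb; apply: filterS I_LDP => x ldp; exact: (ldp_half_line_ge ldp N_gt0 zt Izb).
Qed.

Lemma ball_prob_cvg (t : R) (L : \bar R) : (forall z, (z <= t)%R -> L <= I z) ->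
  ereal_inf (I @` [set z | (z < t)%R]) <= L ->
  {ae P, forall x, (fun n => - ((N n)^-1%:E *
    lne (Q_ n (distortion_ball rho (restr (cube d n) x) t)))) @ \oo --> L}.
Proof.
move=> LI IL; apply: filterS I_LDP => x ldp; rewrite -[L]oppeK; apply: cvgeN.
apply: cvg_limn_esup_einf.
  exact: (ldp_half_line_esup ldp LI).
exact: (ldp_half_line_einf ldp IL).
Qed.

(** A decreasing affine minorant of [I] is also a minorant of its infimum over
[z <= t], taken at [t]; this is the exponent of the ball of radius [t]. *)
Lemma R_seq_ge_minorant (D j l e : R) : (l <= 0)%R -> (0 < e)%R ->
  (forall z, (j + l * (z - D))%:E <= I z) ->
  \forall n \near \oo, (j - e)%:E <= R_seq rho P Q D n.
Proof.
move=> l0 e0 jI; have e40 : (0 < e / 4)%R by rewrite divr_gt0.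
have := @R_seq_ge_eventually _ _ _ _ _ _ rho mrho rho0 M rhoM P Q D l j _ d_gt0 l0 e40.
case=> [t|]; last first.
  by move=> n0 _ H; exists n0 => // n /H; rewrite mulrC divfK.
apply: (ball_prob_le e40) => z zt; apply: le_trans (jI z).
by rewrite lee_fin lerD2l ler_wnM2l// lerB.
Qed.

(** The ball used for the coupling has a radius strictly between [z] and [D]: the
lower bound on its probability needs room above [z], and the truncation of the
coupling needs room below [D]. *)
Lemma R_seq_le_rate (D z b : R) : (z < D)%R -> I z < b%:E ->
  \forall n \near \oo, R_seq rho P Q D n <= b%:E.
Proof.
move=> zD Izb.
have z0 : (0 <= z)%R by rewrite leNgt; apply/negP => /I_lt0 Iz; rewrite Iz in Izb.
have b0 : (0 <= b)%R by rewrite -lee_fin (le_trans (I0 z))// ltW.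
have D'D : (0 <= (z + D) / 2 < D)%R by apply/andP; split; lra.
apply: (R_seq_le_eventually mrho rho0 rhoM D'D b0).
by apply: (ball_prob_ge _ Izb); lra.
Qed.

(** The affine functions of arbitrarily large value [j] at [D] that vanish at
[D'] are minorants of [I]: left of [D'] there is nothing to check, and right of
[D'] they are nonpositive. *)
Lemma R_seq_cvg_infty (D D' : R) : (D < D')%R -> (forall z, (z < D')%R -> I z = +oo) ->
  R_seq rho P Q D @ \oo --> +oo.
Proof.
move=> DD' IoO; apply/cvgeyPge => K.
pose j := (`|K| + 1)%R.
have j0 : (0 <= j)%R by rewrite addr_ge0.
have l0 : (- (j / (D' - D)) <= 0)%R by rewrite oppr_le0 divr_ge0// subr_ge0 ltW.
have := @R_seq_ge_minorant D j _ 1%R l0 ltr01; case.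
  move=> z; have [zD'|zD'] := ltP z D'; first by rewrite IoO// leey.
  apply: le_trans (I0 z); rewrite lee_fin mulNr subr_le0 mulrAC ler_pdivlMr ?subr_gt0//.
  by rewrite ler_wpM2l// lerB.
move=> n0 _ H; exists n0 => // n /H; apply: le_trans.
by rewrite lee_fin /j addrK ler_norm.
Qed.

(** The limit is the exponent of the ball probabilities: a point [z < D] that
nearly realizes the infimum gives the upper bound, and a subgradient at [D]
gives the lower bound. *)
Lemma R_seq_cvg_inf (D z0 : R) : (z0 < D)%R -> I z0 < +oo ->
  R_seq rho P Q D @ \oo --> ereal_inf (I @` [set z | (z <= D)%R]).
Proof.
move=> z0D Iz0; set L := ereal_inf _.
have L_lb z : (z <= D)%R -> L <= I z by move=> zD; apply: ereal_inf_lbound; exists z.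
have : L < +oo by apply: le_lt_trans Iz0; exact/L_lb/ltW.
have : 0 <= L by apply: le_ereal_inf_tmp => _ [z _ <-].
case LE : L => [j| |]// _ _.
rewrite LE in L_lb; have [l l0 jI] := convex_subgradient I0 I_convex z0D Iz0 L_lb.
apply: cvg_limn_esup_einf.
  apply/lee_addgt0Pr => e e0; apply: limn_esup_le_near; rewrite -EFinD.
  have /ereal_inf_lt[_ [z zD <-] Iz] :
      ereal_inf (I @` [set z | (z < D)%R]) < (j + e)%:E.
    apply: (le_lt_trans (convex_inf_half_line I0 I_convex z0D Iz0)).
    by rewrite -/L LE lte_fin ltrDl.
  exact: (R_seq_le_rate zD Iz).
apply/lee_addgt0Pr => e e0; rewrite -leeBlDr//; apply: le_limn_einf_near.
exact: R_seq_ge_minorant jI.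
Qed.

(** At the left end of the domain of [I]: every level above [D] is in the set
whose infimum defines [D_min_infty], since all but finitely many terms are
bounded by a value of [I] and each of the others is finite above [D_min]; no
level below [D] is in it, since there the sequence tends to infinity. *)
Lemma D_min_infty_boundary (D : R) : D_min rho P Q < D%:E ->
  (forall z, (z < D)%R -> I z = +oo) ->
  (forall D', (D < D')%R -> exists2 z, (z < D')%R & I z < +oo) ->
  D_min_infty rho P Q = D%:E.
Proof.
move=> DminD Ioo Ifin.
have D0 : (0 <= D)%R.
  rewrite leNgt; apply/negP => /Ifin[z /I_lt0 ->].
  by rewrite ltxx.
apply/eqP; rewrite eq_le; apply/andP; split.
  apply/lee_addgt0Pr => e e0; rewrite -EFinD; apply: ereal_inf_lbound.
  exists (D + e)%R => //; split; first by rewrite addr_ge0// ltW.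
  have [|z zD Iz] := Ifin (D + e)%R; first by rewrite ltrDl.
  have [u Iu] : exists u, I z = u%:E.
    by case: (I z) (I0 z) Iz => // u _ _; exists u.
  have Iz1 : I z < (u + 1)%:E by rewrite Iu lte_fin ltrDl.
  have [n0 _ Hn0] := R_seq_le_rate zD Iz1.
  have [b Hb] : exists b : R, forall n, (1 <= n < n0)%N -> R_seq rho P Q (D + e) n <= b%:E.
    elim: n0 {Hn0} => [|m [b Hb]]; first by exists 0%R => n; rewrite ltn0 andbF.
    have [->|m0] := eqVneq m 0%N; first by exists 0%R => -[].
    have : R_seq rho P Q (D + e) m < +oo.
      apply: (R_seq_lty mrho rho0 rhoM); first by rewrite lt0n.
      apply: (@le_lt_trans _ _ (D_min rho P Q)).
        by apply: ereal_sup_ubound; exists m => //=; rewrite lt0n.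
      by apply: (lt_trans DminD); rewrite lte_fin ltrDl.
    move=> mfin; have [c Hc] : exists c : R, R_seq rho P Q (D + e) m <= c%:E.
      move: mfin; case: (R_seq _ _ _ _ _) => [c| |]// _; first by exists c.
      by exists 0%R; rewrite leNye.
    exists (Num.max b c) => n /andP[n1]; rewrite ltnS leq_eqVlt => /predU1P[->|nm].
      by apply: (le_trans Hc); rewrite lee_fin le_max lexx orbT.
    by apply: (@le_trans _ _ b%:E); rewrite ?Hb ?n1// lee_fin le_max lexx.
  apply: (@le_lt_trans _ _ (Num.max b (u + 1))%:E); last exact: ltry.
  apply: ge_ereal_sup => _ [n /= n1 <-]; have [nn0|nn0] := ltnP n n0.
    by apply: (@le_trans _ _ b%:E); rewrite ?Hb ?n1// lee_fin le_max lexx.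
  by apply: (le_trans (Hn0 n nn0)); rewrite lee_fin le_max lexx orbT.
apply: le_ereal_inf_tmp => _ [E [E0 supE] <-]; rewrite lee_fin leNgt; apply/negP => ED.
have /cvgeyPge := R_seq_cvg_infty ED Ioo.
case: (ereal_sup _) supE (@ereal_sup_ubound _
    [set R_seq rho P Q E n | n in [set n | (1 <= n)%N]])
  => [K| |]// _ ub.
  move=> /(_ (K + 1)%R)[n _ /(_ (maxn n 1)) /=]; rewrite leq_maxl => /(_ isT).
  apply/negP; rewrite -ltNge; apply: (@le_lt_trans _ _ K%:E).
    by apply: ub; exists (maxn n 1) => //=; rewrite leq_maxr.
  by rewrite lte_fin ltrDl.
move=> /(_ 0%R)[n _ /(_ (maxn n 1)) /=]; rewrite leq_maxl => /(_ isT).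
apply/negP; rewrite -ltNge; apply: (@le_lt_trans _ _ -oo); last exact: ltNyr.
by apply: ub; exists (maxn n 1) => //=; rewrite leq_maxr.
Qed.

(** Three cases: [I] is finite somewhere to the left of [D], or infinite up to
some point to the right of [D], or [D] is the left end of its domain. *)
Lemma R_seq_ball_cvg (D : R) : D_min rho P Q < D%:E -> D%:E <> D_min_infty rho P Q ->
  exists2 L : \bar R, R_seq rho P Q D @ \oo --> L &
    {ae P, forall x, (fun n => - ((N n)^-1%:E *
      lne (Q_ n (distortion_ball rho (restr (cube d n) x) D)))) @ \oo --> L}.
Proof.
move=> DminD Dneq.
have [[z0 z0D Iz0]|nfin] := pselect (exists2 z0, (z0 < D)%R & I z0 < +oo).
  exists (ereal_inf (I @` [set z | (z <= D)%R])); first exact: R_seq_cvg_inf Iz0.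
  apply: ball_prob_cvg; last exact: convex_inf_half_line Iz0.
  by move=> z zD; apply: ereal_inf_lbound; exists z.
have Ioo z : (z < D)%R -> I z = +oo.
  move=> zD; apply/eqP; rewrite -leye_eq leNgt; apply/negP => Iz.
  by apply: nfin; exists z.
have [[D' DD' IooD']|nD'] := pselect (exists2 D', (D < D')%R &
    forall z, (z < D')%R -> I z = +oo).
  exists +oo; first exact: R_seq_cvg_infty IooD'.
  apply: ball_prob_cvg; last by rewrite leey.
  by move=> z zD; rewrite IooD'//; exact: le_lt_trans DD'.
exfalso; apply: Dneq; apply/esym/D_min_infty_boundary => // D' DD'.
apply: contrapT => nz; apply: nD'; exists D' => // z zD'.
apply/eqP; rewrite -leye_eq leNgt; apply/negP => Iz.
by apply: nz; exists z.
Qed.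

End asymptotics.

Theorem theorem27 (R : realType) (d : nat) (hd : (2 <= d)%N)
  (A B : completeMetricType R)
  (sepA : separable_space A) (sepB : separable_space B)
  (rho : borel A * borel B -> R)
  (rho_meas : measurable_fun setT rho)
  (rho_ge0 : forall z, 0 <= rho z)
  (rho_bounded : exists M : R, forall z, rho z <= M)
  (dO : measure_display) (Omega : measurableType dO) (Pr : probability Omega R)
  (X : {RV Pr >-> conf 'rV[int]_d (borel A)})
  (Y : {RV Pr >-> conf 'rV[int]_d (borel B)})
  (XY_indep : independent_rv Pr X Y)
  (X_stat : stationary (distribution Pr X))
  (Y_stat : stationary (distribution Pr Y))
  (Dmin_lt_Dav : (D_min rho (distribution Pr X) (distribution Pr Y)
                  < D_av rho (distribution Pr X) (distribution Pr Y))%E)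
  (I : R -> \bar R) (I_convex : convex_ereal I)
  (I_LDP : {ae marginal (distribution Pr X) (orthant d), forall x : conf (orthant d) (borel A),
     LDP Pr
       (fun n w => rho_n rho (relabel (subfun (cube_orthant n)) x)
                             (restr (cube d n) (Y w)))
       (fun n => (n ^ d)%:R) I}) :
  forall D : R,
    (D_min rho (distribution Pr X) (distribution Pr Y) < D%:E)%E ->
    (D%:E < D_av rho (distribution Pr X) (distribution Pr Y))%E ->
    D%:E <> D_min_infty rho (distribution Pr X) (distribution Pr Y) ->
    cvgn (R_seq rho (distribution Pr X) (distribution Pr Y) D) /\
    {ae Pr, forall w,
      (fun n => - ((n ^ d)%:R^-1%:E
         * lne (marginal (distribution Pr Y) (cube d n)
             (distortion_ball rho (restr (cube d n) (X w)) D))))%E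
        @ \oo --> R_lim rho (distribution Pr X) (distribution Pr Y) D}.
Proof.
move=> D DminD _ Dneq; have [M rhoM] := rho_bounded.
have d0 : (0 < d)%N by exact: leq_trans hd.
have ldp : {ae distribution Pr X, forall x, LDP Pr
    (fun n w => rho_n rho (restr (cube d n) x) (restr (cube d n) (Y w)))
    (fun n => (n ^ d)%:R) I}.
  exact: (ae_distribution I_LDP).
have [L RL ballL] :=
  R_seq_ball_cvg d0 rho_meas rho_ge0 rhoM I_convex ldp DminD Dneq.
rewrite /R_lim (cvg_lim _ RL)//; split => //.
exact: (ae_distribution ballL).
Qed.
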